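(* Let $\lambda>0$, $\mu>-1$, and let $n\ge 0$ be an integer. For $0\le j\le n/2$ put $\beta_j:=n-2j+\frac{d-2}{2}$, let $q_k^{(\mu,\beta_j)}(t)$ be the $k$-th Sobolev orthogonal polynomial associated with the inner product $(\cdot,\cdot)_{\mu,\beta_j}$, and let $\{Y_\nu^{n-2j}:1\le\nu\le a_{n-2j}^d\}$ be an orthonormal basis of $\mathcal H_{n-2j}^d$. Define $$R_{j,\nu}^n(x):=q_j^{(\mu,\beta_j)}(2\|x\|^2-1)\,Y_\nu^{n-2j}(x).$$ Then $\{R_{j,\nu}^n: 0\le j\le n/2,\ 1\le\nu\le a_{n-2j}^d\}$ is a mutually orthogonal basis of $\mathcal V_n^d(\nabla,W_\mu,\mathbb B^d)$. Moreover, $$\langle R_{j,\nu}^n,R_{j,\nu}^n\rangle_{\nabla,W_\mu,\mathbb B^d}=\frac{\Gamma(\mu+1+\frac d2)}{\Gamma(\mu+1)\,\Gamma(\frac d2)\,2^{\beta_j+\mu}}\,\bigl(q_j^{(\mu,\beta_j)},q_j^{(\mu,\beta_j)}\bigr)_{\mu,\beta_j}.$$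
   Context: $d$ is a positive integer, $\mathbb B^d=\{x\in\mathbb R^d:\|x\|\le1\}$, $W_\mu(x)=(1-\|x\|^2)^\mu$, $b_\mu=\bigl(\int_{\mathbb B^d}W_\mu(x)\,dx\bigr)^{-1}=\frac{\Gamma(\mu+d/2+1)}{\pi^{d/2}\Gamma(\mu+1)}$. For real polynomials $f,g$ in $d$ variables, $$\langle f,g\rangle_{\nabla,W_\mu,\mathbb B^d}:=b_\mu\Bigl[\int_{\mathbb B^d}f(x)g(x)W_\mu(x)\,dx+\lambda\int_{\mathbb B^d}\nabla f(x)\cdot\nabla g(x)\,W_\mu(x)\,dx\Bigr].$$ $\mathcal V_n^d(\nabla,W_\mu,\mathbb B^d)$ is the linear space of polynomials of total degree $n$ (together with $0$) that are orthogonal, with respect to this inner product, to all polynomials of total degree less than $n$. A basis is mutually orthogonal if distinct elements are orthogonal to each other. $\mathcal H_m^d$ is the space of homogeneous polynomials of degree $m$ in $d$ variables with $\Delta Y=0$, $a_m^d=\dim\mathcal H_m^d$; orthonormality in $\mathcal H_m^d$ is with respect to $\langle f,g\rangle_{\mathbb S^{d-1}}=\frac1{\omega_d}\int_{\mathbb S^{d-1}}fg\,d\sigma$, where $d\sigma$ is surface measure on the unit sphere $\mathbb S^{d-1}$ and $\omega_d=\int_{\mathbb S^{d-1}}d\sigma$. One-variable Sobolev inner product: let $w_{\alpha,\beta}(t)=(1-t)^\alpha(1+t)^\beta$ on $(-1,1)$. For $\alpha>-1$ and $\beta>\max\{0,\frac{d-2}2\}$, $$(f,g)_{\alpha,\beta}:=\int_{-1}^1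 fg\,w_{\alpha,\beta}\,dt+2\lambda\int_{-1}^1\bigl[A\,fg+B(1+t)(fg'+f'g)+4(1+t)^2f'g'\bigr]w_{\alpha,\beta-1}\,dt,$$ with $B=B(\beta,d)=2\beta-(d-2)$ and $A=A(\beta,d)=\beta B(\beta,d)$. In the case $\beta=\frac{d-2}2$, where $A=B=0$, it is $$(f,g)_{\alpha,\beta}:=\int_{-1}^1 fg\,w_{\alpha,\beta}\,dt+8\lambda\int_{-1}^1f'g'\,w_{\alpha,\beta+1}\,dt.$$ $q_k^{(\alpha,\beta)}$ is the polynomial of degree $k$ that is orthogonal with respect to $(\cdot,\cdot)_{\alpha,\beta}$ to all polynomials of degree less than $k$, normalized to have the same leading coefficient as the Jacobi polynomial $P_k^{(\alpha,\beta)}$, namely $\frac1{2^k}\binom{2k+\alpha+\beta}{k}$ (for $k=0$, this is $1$).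
   Formalization: The printed norm formula is too large by a factor of 2 (for n = 0 the left side is 1 and the right side 2); the formal statement has 2^{β_j+μ+1} in place of 2^{β_j+μ} in the denominator. *)

(* Defs.v *)
From HB Require Import structures.
From mathcomp Require Import all_boot all_order all_algebra.
(* The notations of [mpoly] clash with those of MathComp-Analysis. *)
From mathcomp Require Import -(notations) mpoly.
From mathcomp Require Import all_classical all_reals all_analysis.
From mathcomp Require Import measurable_realfun.

Set Implicit Arguments.
Unset Strict Implicit.
Unset Printing Implicit Defensive.

Import Order.TTheory GRing.Theory Num.Theory.
Import numFieldNormedType.Exports.

Local Open Scope classical_set_scope.
Local Open Scope ring_scope.

Section basis.
Context {K : fieldType} {V : lmodType K}.

Definition is_basis (S : set V) (I : finType) (b : I -> V) : Prop :=
  [/\ forall i, S (b i),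
      forall c : I -> K, \sum_i c i *: b i = 0 -> forall i, c i = 0
    & forall v, S v -> exists c : I -> K, v = \sum_i c i *: b i].

(* The value is 0 when [S] is not finite-dimensional. *)
Definition dimension (S : set V) : nat :=
  xget 0%N [set k | exists b : 'I_k -> V, is_basis S b].

End basis.

Notation Rn R d := (d.-tuple (measurableTypeR R)).

Section lebesgue_n.
Context {R : realType}.

Definition Rn_cons d (p : measurableTypeR R * Rn R d) : Rn R d.+1 :=
  [tuple of p.1 :: p.2].

Lemma measurable_Rn_cons d : measurable_fun setT (@Rn_cons d).
Proof. by apply: measurable_cons. Qed.

Section lebesgue_cons.
Context (d : nat) (m : {sigma_finite_measure set (Rn R d) -> \bar R}).

Definition lebesgue_cons : set (Rn R d.+1) -> \bar R :=
  pushforward (lebesgue_measure \x m)%E (@Rn_cons d).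

Let mcons : measurable_fun setT (@Rn_cons d) := @measurable_Rn_cons d.

Let lebesgue_cons0 : lebesgue_cons set0 = 0%E.
Proof. exact: measure0. Qed.

Let lebesgue_cons_ge0 A : (0 <= lebesgue_cons A)%E.
Proof. exact: measure_ge0. Qed.

Let lebesgue_cons_sigma_additive : semi_sigma_additive lebesgue_cons.
Proof. exact: measure_semi_sigma_additive. Qed.

HB.instance Definition _ := isMeasure.Build _ _ _ lebesgue_cons
  lebesgue_cons0 lebesgue_cons_ge0 lebesgue_cons_sigma_additive.

Let product_sigma_finite : sigma_finite setT (lebesgue_measure \x m)%E.
Proof.
have /sigma_finiteP[F [TF ndF Foo]] :=
  sigma_finiteT (@lebesgue_measure R : {sigma_finite_measure set _ -> \bar R}).
have /sigma_finiteP[G [TG ndG Goo]] := sigma_finiteT m.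
exists (fun n => F n `*` G n).
  rewrite -setXTT TF TG predeqE => -[x y]; split.
    move=> [/= [n _ Fnx] [k _ Gky]]; exists (maxn n k) => //; split.
    - by move: x Fnx; exact/subsetPset/ndF/leq_maxl.
    - by move: y Gky; exact/subsetPset/ndG/leq_maxr.
  by move=> [n _ []/= ? ?]; split; exists n.
move=> k; have [? ?] := Foo k; have [? ?] := Goo k.
split; first exact: measurableX.
by rewrite product_measure1E// lte_mul_pinfty// ge0_fin_numE.
Qed.

Let lebesgue_cons_sigma_finite : sigma_finite setT lebesgue_cons.
Proof.
have [F FT Foo] := product_sigma_finite.
pose unc (x : Rn R d.+1) : measurableTypeR R * Rn R d :=
  (thead x, [tuple of behead x]).
have consK x : Rn_cons (unc x) = x by rewrite [RHS]tuple_eta; exact: val_inj.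
have uncK p : unc (Rn_cons p) = p.
  by case: p => a b; rewrite /unc theadE; congr pair; exact: val_inj.
have munc : measurable_fun setT unc.
  apply/measurable_fun_pairP; split; first exact: measurable_tnth.
  exact: measurable_behead.
exists (fun k => unc @^-1` F k).
  by rewrite -preimage_bigcup -FT preimage_setT.
move=> k; have [mF oo] := Foo k; split.
  by rewrite -[X in measurable X]setTI; exact: munc.
rewrite /lebesgue_cons /pushforward -comp_preimage.
by rewrite (_ : unc \o _ = id)//; apply/funext => p; exact: uncK.
Qed.

HB.instance Definition _ := Measure_isSigmaFinite.Build _ _ _ lebesgue_cons
  lebesgue_cons_sigma_finite.

End lebesgue_cons.

Fixpoint lebesgue_n (d : nat) : {sigma_finite_measure set (Rn R d) -> \bar R} :=
  if d is d'.+1 then lebesgue_cons (lebesgue_n d')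
  else dirac ([tuple] : Rn R 0).

End lebesgue_n.
Arguments lebesgue_n R d : clear implicits.

Section euclidean.
Context {R : realType} {d : nat}.
Implicit Types (x : Rn R d).

Definition enorm x : R := Num.sqrt (\sum_i tnth x i ^+ 2).

Definition unit_ball : set (Rn R d) := [set x | enorm x <= 1].

Definition unit_sphere : set (Rn R d) := [set x | enorm x = 1].

Definition punctured_ball : set (Rn R d) := [set x | 0 < enorm x <= 1].

Definition direction x : Rn R d := [tuple tnth x i / enorm x | i < d].

Lemma measurable_enorm : measurable_fun setT enorm.
Proof.
have msqrt : measurable_fun setT (@Num.sqrt R) :=
  continuous_measurable_fun (@sqrt_continuous R).
have msum : measurable_fun setT (fun x : Rn R d => \sum_i tnth x i ^+ 2 : R).
  apply: measurable_sum => i; apply: measurable_funX; exact: measurable_tnth.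
exact: measurableT_comp msqrt msum.
Qed.

Lemma measurable_direction : measurable_fun setT direction.
Proof.
apply/measurable_fun_tnthP => i.
rewrite (_ : _ \o _ = fun x => tnth x i * (enorm x) `^ (-1)); last first.
  by apply/funext => x; rewrite /= tnth_mktuple powR_inv1// sqrtr_ge0.
have h : measurable_fun setT (fun x => enorm x `^ (-1)).
  exact: measurableT_comp (@measurable_powR R (-1)) measurable_enorm.
apply: measurable_funM h; exact: measurable_tnth.
Qed.

Lemma measurable_punctured_ball : measurable punctured_ball.
Proof.
rewrite (_ : punctured_ball = setT `&` enorm @^-1` `]0, 1]%classic).
  by apply: measurable_enorm => //; exact: measurable_itv.
by apply/seteqP; split => x /=; rewrite in_itv/= ?setTI// => -[].
Qed.

(* Surface measure on the unit sphere, as a measure on R^d carried by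
   [unit_sphere]: sigma(A) = d * Leb {x | 0 < |x| <= 1, x / |x| \in A}, so that
   dx = r^(d-1) dr dsigma in polar coordinates. For d = 1 it is the counting
   measure on {-1, 1}. *)
Definition surface_measure (A : set (Rn R d)) : \bar R :=
  (d%:R%:E * lebesgue_n R d (direction @^-1` A `&` punctured_ball))%E.

Let cone : {measure set (Rn R d) -> \bar R} :=
  mrestr (lebesgue_n R d) measurable_punctured_ball.

Let scaled_cone : {measure set (Rn R d) -> \bar R} :=
  mscale (@NngNum R d%:R (ler0n _ _))
    (measure_function_pushforward__canonical__measure_function_Measure cone
       measurable_direction).

Let surface_measure0 : surface_measure set0 = 0%E.
Proof. exact: (measure0 scaled_cone). Qed.

Let surface_measure_ge0 A : (0 <= surface_measure A)%E.
Proof. exact: (measure_ge0 scaled_cone). Qed.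

Let surface_measure_sigma_additive : semi_sigma_additive surface_measure.
Proof. exact: (@measure_semi_sigma_additive _ _ _ scaled_cone). Qed.

HB.instance Definition _ := isMeasure.Build _ _ _ surface_measure
  surface_measure0 surface_measure_ge0 surface_measure_sigma_additive.

End euclidean.
Arguments unit_ball R d : clear implicits.
Arguments unit_sphere R d : clear implicits.
Arguments surface_measure R d : clear implicits.

Section polynomials.
Context {R : realType} {d : nat}.
Implicit Types (f g p Y : mpoly d R) (x : Rn R d).

Definition mpeval p x : R := meval (tnth x) p.

(* The number [mpsize p] is 1 + the total degree of [p], and 0 if p = 0. *)
Definition mpsize p : nat := mmeasure mdeg p.

Definition grad_dot f g : mpoly d R := \sum_i mderiv i f * mderiv i g.

Definition laplacian f : mpoly d R := \sum_i mderiv i (mderiv i f).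

Definition normsq_poly : mpoly d R := \sum_(i < d) mpolyX R (mnm1 i) ^+ 2.

Definition harmonic_poly (m : nat) : set (mpoly d R) :=
  [set Y | Y \is ishomog1 m mdeg /\ laplacian Y = 0].

Definition sphere_dot f g : R :=
  (\int[surface_measure R d]_(x in unit_sphere R d) 1)^-1 *
  \int[surface_measure R d]_(x in unit_sphere R d) (mpeval f x * mpeval g x).

Definition ball_weight (mu : R) x : R := (1 - enorm x ^+ 2) `^ mu.

Definition ball_const (mu : R) : R :=
  (\int[lebesgue_n R d]_(x in unit_ball R d) ball_weight mu x)^-1.

Definition ball_dot (lam mu : R) f g : R :=
  ball_const mu *
  (\int[lebesgue_n R d]_(x in unit_ball R d)
      (mpeval f x * mpeval g x * ball_weight mu x)
   + lam * \int[lebesgue_n R d]_(x in unit_ball R d)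
      (mpeval (grad_dot f g) x * ball_weight mu x)).

Definition ball_ortho (lam mu : R) (n : nat) : set (mpoly d R) :=
  [set p | (p = 0 \/ mpsize p = n.+1) /\
           forall g, (mpsize g <= n)%N -> ball_dot lam mu p g = 0].

(* The polynomial x |-> q(2 |x|^2 - 1) Y(x). *)
Definition radial_mul (q : {poly R}) Y : mpoly d R :=
  horner_alg (2%:R *: normsq_poly - 1) q * Y.

Lemma mpeval_normsq x : mpeval normsq_poly x = enorm x ^+ 2.
Proof.
rewrite /mpeval /normsq_poly /enorm sqr_sqrtr; last first.
  by apply: sumr_ge0 => i _; exact: sqr_ge0.
rewrite raddf_sum/=; apply: eq_bigr => i _.
by rewrite rmorphXn/= mevalXU.
Qed.

Lemma mpeval_radial_mul q Y x :
  mpeval (radial_mul q Y) x = q.[2%:R * enorm x ^+ 2 - 1] * mpeval Y x.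
Proof.
rewrite /mpeval /radial_mul rmorphM/=; congr (_ * _).
set u := _ - 1.
have ux : meval (tnth x) u = 2%:R * enorm x ^+ 2 - 1.
  by rewrite /u rmorphB/= mevalZ -/(mpeval _ x) mpeval_normsq rmorph1.
rewrite -ux; elim/poly_ind: q => [|p c IH]; first by rewrite !raddf0 horner0.
rewrite rmorphD rmorphM/= horner_algX horner_algC rmorphD rmorphM/= IH.
by rewrite mevalZ rmorph1 mulr1 hornerMXaddC.
Qed.

End polynomials.
Arguments harmonic_poly R d m : clear implicits.
Arguments ball_ortho R d lam mu n : clear implicits.

Section sobolev1.
Context {R : realType}.
Implicit Types (f g q : {poly R}).

Definition jacobi_weight (alpha beta t : R) : R :=
  (1 - t) `^ alpha * (1 + t) `^ beta.

Definition sob_B (d : nat) (beta : R) : R := 2%:R * beta - (d%:R - 2%:R).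

Definition sob_A (d : nat) (beta : R) : R := beta * sob_B d beta.

(* The first branch is the exceptional case, where A = B = 0 and
   [jacobi_weight alpha (beta - 1)] may fail to be integrable. *)
Definition sob_dot (d : nat) (lam alpha beta : R) f g : R :=
  if beta == (d%:R - 2%:R) / 2%:R then
    \int[lebesgue_measure]_(t in `]-1, 1[)
        (f.[t] * g.[t] * jacobi_weight alpha beta t)
    + 8%:R * lam * \int[lebesgue_measure]_(t in `]-1, 1[)
        (f^`().[t] * g^`().[t] * jacobi_weight alpha (beta + 1) t)
  else
    \int[lebesgue_measure]_(t in `]-1, 1[)
        (f.[t] * g.[t] * jacobi_weight alpha beta t)
    + 2%:R * lam * \int[lebesgue_measure]_(t in `]-1, 1[)
        ((sob_A d beta * (f.[t] * g.[t])
          + sob_B d beta * (1 + t) * (f.[t] * g^`().[t] + f^`().[t] * g.[t])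
          + 4%:R * (1 + t) ^+ 2 * (f^`().[t] * g^`().[t]))
         * jacobi_weight alpha (beta - 1) t).

(* Binomial coefficient with a real upper argument. *)
Definition binomr (x : R) (k : nat) : R := (\prod_(i < k) (x - i%:R)) / k`!%:R.

(* [q] is the [k]-th Sobolev orthogonal polynomial, scaled like the Jacobi
   polynomial P_k^(alpha, beta). *)
Definition is_sob_poly (d : nat) (lam alpha beta : R) (k : nat) q : Prop :=
  [/\ size q = k.+1,
      lead_coef q = binomr ((2 * k)%:R + alpha + beta) k / 2%:R ^+ k
    & forall p : {poly R}, (size p <= k)%N -> sob_dot d lam alpha beta q p = 0].

End sobolev1.

(* The index beta_j; for 2 j <= n the subtraction is exact. *)
Definition sob_beta {R : realType} (d n j : nat) : R :=
  (n - 2 * j)%:R + (d%:R - 2%:R) / 2%:R.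

(* Euler's integral, which converges for s > 0 only. *)
Definition Gamma {R : realType} (s : R) : R :=
  \int[lebesgue_measure]_(t in `]0, +oo[) (t `^ (s - 1) * expR (- t)).

(* Main.v *)
Require Import Defs.
From HB Require Import structures.
From mathcomp Require Import all_boot all_order all_algebra.
From mathcomp Require Import -(notations) mpoly.
From mathcomp Require Import all_classical all_reals all_analysis.
From mathcomp Require Import measurable_realfun ring lra.

(* If p is homogeneous of degree k, integrating phi(|x|^2) p(x) over R^d gives a
   one-dimensional integral of phi against t^((k+d)/2-1) times the integral of p
   over the sphere. Taking phi = exp(-t) turns sphere integrals into Gaussian
   ones, where integration by parts shows that harmonic polynomials Y, Z of
   different degrees are orthogonal, as are their gradients, and that
   grad Y . grad Z integrates over the sphere to m(2m+d-2) times the integral of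
   Y Z when both have degree m. Taking phi supported on [0, 1] reduces the inner
   product of f(2|x|^2-1) Y and g(2|x|^2-1) Z on the ball to a constant times
   <Y, Z> on the sphere times (f, g) with beta = m + (d-2)/2; this gives mutual
   orthogonality and the norms. By Fischer's decomposition
   P_k = sum_j |x|^(2j) H_(k-2j), the same formula shows orthogonality to lower
   degrees and matches the leading part of any element of V_n by a combination
   of the R_(j,nu); the difference is orthogonal to itself, and vanishes because
   the zero set of a nonzero polynomial is a null set. *)

(** The only geometric input is that a dilation by c multiplies volume by c^d. With Tonelli this
    gives polar integration without parametrizing the sphere, and the surface measure, defined
    through cones, fits in directly. The Gaussian takes the place of Green's formula: it is a
    product of one-variable weights, so integration by parts comes down to a recursion on the
    moments of exp(-t^2), itself obtained from polar integration on the line and Gamma(s+1) = s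
    Gamma(s). Integration by parts gives the factor 2m for grad Y . grad Z. The gradients lower the
    total degree by 2, which replaces Gamma(m+d/2) by Gamma(m-1+d/2) in the passage to the sphere;
    the ratio m-1+d/2 completes the constant m(2m+d-2). These are the coefficients of the
    one-variable product: for beta = m+(d-2)/2 one has B = 2m and A = m(2m+d-2). Degree m = 0 is
    separate: there grad Y = 0, and the weight with exponent beta-1 may fail to be integrable.
    Spanning is proved without counting dimensions. *)

Set Implicit Arguments.
Unset Strict Implicit.
Unset Printing Implicit Defensive.

Import Order.TTheory GRing.Theory Num.Theory.
Import numFieldNormedType.Exports.

Local Open Scope classical_set_scope.
Local Open Scope ring_scope.

(** * Integration on the real line *)

Section line.
Context {R : realType}.
Local Notation leb := (@lebesgue_measure R).
Implicit Types (a b p s : R).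

(** The image of Lebesgue measure under x |-> a x + b, multiplied by a, has the right value on
    half-open intervals, hence is Lebesgue measure by uniqueness. *)
Lemma ge0_integral_affine a b (f : R -> \bar R) : 0 < a ->
  measurable_fun setT f -> (forall x, 0 <= f x)%E ->
  (\int[leb]_x f (a * x + b)%R = a^-1%:E * \int[leb]_x f x)%E.
Proof.
move=> a0 mf f0.
have maff : measurable_fun setT
    ((fun x => a * x + b) : measurableTypeR R -> measurableTypeR R).
  by apply: measurable_funD => //; exact: measurable_funM.
pose k := NngNum (ltW a0).
pose m : {measure set (measurableTypeR R) -> \bar R} := mscale k
  (measure_function_pushforward__canonical__measure_function_Measure leb maff).
have mE A : measurable A -> m A = leb A.
  move=> mA; apply/esym/lebesgue_measure_unique => //= _ [[u v]] _ <-.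
  rewrite /m /mscale/= /pushforward.
  have -> : (fun x => a * x + b) @^-1` `]u, v] = `](u - b) / a, (v - b) / a]%classic.
    apply/seteqP; split => x /=; rewrite !in_itv/= ltr_pdivrMr// ler_pdivlMr//;
      by rewrite ltrBlDr lerBrDr (mulrC x).
  rewrite !lebesgue_measure_itv/= !lte_fin ltr_pM2r ?invr_gt0// ltrD2r.
  case: ifPn => _; last by rewrite mule0.
  rewrite -!EFinB -EFinM; congr EFin; field; exact: lt0r_neq0.
rewrite -[in RHS](@eq_measure_integral _ _ _ _ leb m)//; last by move=> A mA _; exact: mE.
rewrite ge0_integral_mscale//=.
rewrite (ge0_integral_pushforward maff leb measurableT mf)//=.
by rewrite muleA -EFinM mulVf ?mul1e// lt0r_neq0.
Qed.

Lemma ge0_integral_opp (f : R -> \bar R) :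
  measurable_fun setT f -> (forall x, 0 <= f x)%E ->
  (\int[leb]_x f (- x)%R = \int[leb]_x f x)%E.
Proof.
move=> mf f0.
rewrite -[in RHS](@eq_measure_integral _ _ _ _ leb
  (pushforward leb (-%R : _ -> measurableTypeR R))).
  have mopp : measurable_fun setT (-%R : measurableTypeR R -> measurableTypeR R).
    by [].
  by rewrite (ge0_integral_pushforward mopp leb measurableT mf).
by move=> A mA _; exact: lebesgue_measureN.
Qed.

(** Scaling by a > 0 fixes both infinities, so it respects even the conventional value of +oo - +oo.
    This frees the substitution rule below from any integrability assumption. *)
Lemma gt0_muleBr a (x y : \bar R) : 0 < a -> (0 <= x)%E -> (0 <= y)%E ->
  (a%:E * (x - y) = a%:E * x - a%:E * y)%E.
Proof.
move=> a0; have a'0 : (0 < a%:E)%E by rewrite lte_fin.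
case: x y => [u| |] [v| |]//= _ _.
- by rewrite -EFinB -!EFinM -EFinB mulrBr.
- by rewrite gt0_muley//= gt0_muleNy.
- by rewrite gt0_muley//= gt0_muley.
- by rewrite gt0_muley//= gt0_muleNy.
Qed.

Lemma integral_affine a b (f : R -> \bar R) : 0 < a -> measurable_fun setT f ->
  (\int[leb]_x f (a * x + b)%R = a^-1%:E * \int[leb]_x f x)%E.
Proof.
move=> a0 mf; rewrite integralE [in RHS]integralE.
have E1 := @ge0_integral_affine a b _ a0 (measurable_funepos mf) (funepos_ge0 f).
have E2 := @ge0_integral_affine a b _ a0 (measurable_funeneg mf) (funeneg_ge0 f).
transitivity (a^-1%:E * \int[leb]_x f^\+ x - a^-1%:E * \int[leb]_x f^\- x)%E.
  by rewrite -E1 -E2; congr (_ - _)%E; apply: eq_integral => x _;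
    rewrite ?funeposE ?funenegE.
by apply/esym/gt0_muleBr; rewrite ?invr_gt0//; exact: integral_ge0.
Qed.

Lemma Rintegral_affine a b (f : R -> R) : 0 < a -> measurable_fun setT f ->
  \int[leb]_x f (a * x + b) = a^-1 * \int[leb]_x f x.
Proof.
move=> a0 mf; rewrite /Rintegral.
rewrite (@integral_affine a b (EFin \o f))//; last exact/measurable_EFinP.
have a'0 : (0 < a^-1%:E)%E by rewrite lte_fin invr_gt0.
(* Both integrals are infinite together, and [fine] sends infinite values to 0. *)
case: (integral _ _ _) => [u| |]//=.
  by rewrite gt0_muley//= mulr0.
by rewrite gt0_muleNy//= mulr0.
Qed.

(** The truncated power, zero for t <= 0 even when p = 0. Weights become functions on the whole
    line, so that substitutions need no care for domains. *)
Definition ppow p t : R := if 0 < t then t `^ p else 0.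

Lemma ppow_ge0 p t : 0 <= ppow p t.
Proof. by rewrite /ppow; case: ifP => // _; exact: powR_ge0. Qed.

Lemma ppow_gt0E p t : 0 < t -> ppow p t = t `^ p.
Proof. by rewrite /ppow => ->. Qed.

Lemma ppow_le0E p t : t <= 0 -> ppow p t = 0.
Proof. by rewrite /ppow leNgt => /negbTE ->. Qed.

Lemma measurable_ppow p : measurable_fun setT (ppow p).
Proof.
apply: measurable_fun_ifT; [exact: measurable_fun_ltr|exact: measurable_powR|].
by [].
Qed.

Lemma ppowZ p a t : 0 < a -> ppow p (a * t) = a `^ p * ppow p t.
Proof.
move=> a0; rewrite /ppow pmulr_rgt0//; case: ifP => t0; last by rewrite mulr0.
by rewrite powRM// ltW.
Qed.

Lemma ppowD p s t : ppow (p + s) t = ppow p t * ppow s t.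
Proof.
rewrite /ppow; case: ifP => t0; last by rewrite mulr0.
by rewrite powRD ?(gt_eqF t0)?implybT.
Qed.


Lemma integral_mulppow p (f : R -> R) :
  (\int[leb]_t (f t * ppow p t)%:E = \int[leb]_(t in `]0%R, +oo[) (f t * t `^ p)%:E)%E.
Proof.
rewrite [in RHS]integral_mkcond; apply: eq_integral => t _.
rewrite patchE /ppow mem_setE in_itv/= andbT.
by case: ifP => //; rewrite mulr0.
Qed.

(** For p < 1 the integrand is unbounded at 0. The fundamental theorem is applied on [1/(n+2), 1],
    which is nondegenerate already for n = 0, and monotone convergence gives the limit. *)
Lemma integral_powR01 p : 0 < p ->
  (\int[leb]_(t in `]0%R, 1%R]) (t `^ (p - 1))%:E = p^-1%:E)%E.
Proof.
move=> p0.
pose e n : R := n.+2%:R^-1.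
have e0 n : 0 < e n by rewrite invr_gt0.
have e1 n : e n < 1 by rewrite invf_lt1// ltr1n.
have FTC n : (\int[leb]_(t in `[e n, 1%R]) (t `^ (p - 1))%:E =
    (p^-1 - p^-1 * e n `^ p)%:E)%E.
  pose F (t : R) : R := p^-1 * t `^ p.
  have dF (x : R) : 0 < x -> is_derive x 1 F (x `^ (p - 1)).
    move=> x0; have -> : x `^ (p - 1) = p^-1 *: (p * x `^ (p - 1)).
      by rewrite /GRing.scale/= mulrA mulVf ?mul1r// gt_eqF.
    by apply: is_deriveZ; exact: is_derive1_powR.
  have cF (x : R) : 0 < x -> {for x, continuous F}.
    move=> x0; apply/differentiable_continuous/derivable1_diffP.
    by have [] := dF _ x0.
  rewrite (@continuous_FTC2 _ _ F)//.
  - by rewrite /F powR1 mulr1 -EFinB.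
  - apply: continuous_in_subspaceT => x; rewrite inE/= in_itv/= => /andP[ex _].
    have x0 : 0 < x by exact: lt_le_trans (e0 n) ex.
    apply/differentiable_continuous/derivable1_diffP.
    by apply: derivable_powR; rewrite in_itv/= x0.
  - split.
    + move=> x; rewrite in_itv/= => /andP[ex _].
      by have [] := dF x (lt_trans (e0 n) ex).
    + by apply: cvg_at_right_filter; exact: cF.
    + by apply: cvg_at_left_filter; exact: cF.
  - move=> x; rewrite in_itv/= => /andP[ex _].
    by rewrite derive1E; have [_ ->] := dF x (lt_trans (e0 n) ex).
have e_cvg : e n @[n --> \oo] --> (0 : R).
  by have := @cvg_harmonic R; rewrite -cvg_shiftS.
have -> : `]0, 1]%classic = \bigcup_n `[e n, 1%R]%classic.
  apply/seteqP; split => [x /=|x [n _ /=]]; rewrite !in_itv/=; last first.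
    by move=> /andP[ex ->]; rewrite (lt_le_trans (e0 n) ex).
  move=> /andP[x0 x1].
  have /cvgrPdist_lt/(_ _ x0)[n _ /(_ n (leqnn n))] := e_cvg.
  rewrite sub0r normrN gtr0_norm// => enx; exists n => //=.
  by rewrite in_itv/= x1 andbT ltW.
have cvg1 : (\int[leb]_(t in `[e n, 1%R]) (t `^ (p - 1))%:E)%E @[n --> \oo] -->
    (\int[leb]_(t in \bigcup_n `[e n, 1%R]%classic) (t `^ (p - 1))%:E)%E.
  apply: ge0_nondecreasing_set_cvg_integral => //.
  - move=> m n mn; apply/subsetPset => x/=; rewrite !in_itv/= => /andP[ex ->].
    rewrite andbT (le_trans _ ex)// lef_pV2 ?posrE// ler_nat !ltnS//.
  - by move=> n; apply/measurable_EFinP/measurable_funTS; exact: measurable_powR.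
  - by move=> n x _; rewrite lee_fin powR_ge0.
have cvg2 : (\int[leb]_(t in `[e n, 1%R]) (t `^ (p - 1))%:E)%E @[n --> \oo] --> (p^-1)%:E.
  under eq_fun do rewrite FTC.
  apply: cvg_EFin; last first.
    rewrite (_ : _ \o _ = fun n => p^-1 - p^-1 * e n `^ p); last exact/funext.
    rewrite -[X in _ --> X]subr0 -[X in _ --> _ - X](mulr0 p^-1).
    apply: cvgB; first exact: cvg_cst.
    apply: cvgM; first exact: cvg_cst.
    by move: (powR_cvg0 p0) => /cvg_at_rightP; apply.
  exact: nearW.
by apply: (cvg_unique _ cvg1 cvg2).
Unshelve. all: by end_near. Qed.

End line.

(** * Gamma and Beta functions *)

Section gamma.
Context {R : realType}.
Local Notation leb := (@lebesgue_measure R).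
Implicit Types (a b p s t x z : R).

(** A zero integral would force f to vanish almost everywhere, placing ]u, v[ inside a null set. *)
Lemma ge0_integral_gt0 (f : R -> \bar R) (u v : R) : u < v ->
  measurable_fun setT f -> (forall x, 0 <= f x)%E ->
  (forall x, u < x < v -> (0 < f x)%E) -> (0 < \int[leb]_x f x)%E.
Proof.
move=> uv mf f0 fpos; rewrite lt0e integral_ge0// andbT.
apply/eqP => int0.
have : (\int[leb]_x `|f x| = 0)%E.
  by rewrite -[RHS]int0; apply: eq_integral => x _; rewrite gee0_abs.
move=> /(ae_eq_integral_abs leb measurableT mf)[N [mN N0 fN]].
have : (leb `]u, v[%classic <= leb N)%E.
  apply: le_measure; rewrite ?inE//.
  move=> x /=; rewrite in_itv/= => uxv; apply: fN => /= fx0.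
  by have := fpos x uxv; rewrite fx0// ltxx.
by rewrite N0 lebesgue_measure_itv/= lte_fin uv -EFinB lee_fin subr_le0 leNgt uv.
Qed.

(** Extended values, because the identities between Gamma and Beta integrals come first and
    finiteness is deduced from them. *)
Definition eGamma s : \bar R := (\int[leb]_t (ppow (s - 1) t * expR (- t))%:E)%E.

Definition eBeta a b : \bar R :=
  (\int[leb]_t (ppow (a - 1) t * ppow (b - 1) (1 - t))%:E)%E.

Let gammai_ge0 s t : 0 <= ppow (s - 1) t * expR (- t).
Proof. by rewrite mulr_ge0 ?ppow_ge0 ?expR_ge0. Qed.

Let betai_ge0 a b t : 0 <= ppow (a - 1) t * ppow (b - 1) (1 - t).
Proof. by rewrite mulr_ge0 ?ppow_ge0. Qed.

Let measurable_expRN d (T : measurableType d) (f : T -> R) :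
  measurable_fun setT f -> measurable_fun setT (fun x : T => expR (- f x)).
Proof. by move=> mf; do 2 apply: measurableT_comp => //. Qed.

Let measurable_gammai s :
  measurable_fun setT (fun t : R => (ppow (s - 1) t * expR (- t))%:E).
Proof.
apply/measurable_EFinP.
by apply: measurable_funM; [exact: measurable_ppow|exact: measurable_expRN].
Qed.

Let measurable_betai a b :
  measurable_fun setT (fun t : R => (ppow (a - 1) t * ppow (b - 1) (1 - t))%:E).
Proof.
apply/measurable_EFinP.
apply: measurable_funM; first exact: measurable_ppow.
by apply: measurableT_comp; [exact: measurable_ppow|exact: measurable_funB].
Qed.

Lemma GammaE s : Gamma s = fine (eGamma s).
Proof.
rewrite /Gamma /Rintegral /eGamma; congr fine.
under [RHS]eq_integral do rewrite mulrC.
by rewrite integral_mulppow; apply: eq_integral => t _; rewrite mulrC.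
Qed.

Lemma eGamma_ge0 s : (0 <= eGamma s)%E.
Proof. by apply: integral_ge0 => t _; rewrite lee_fin. Qed.

Lemma eGamma_gt0 s : (0 < eGamma s)%E.
Proof.
apply: (@ge0_integral_gt0 _ 0 1); [exact: ltr01|by []|by move=> t; rewrite lee_fin|].
by move=> t /andP[t0 _]; rewrite lte_fin mulr_gt0 ?expR_gt0// ppow_gt0E// powR_gt0.
Qed.

Lemma eBeta_gt0 a b : (0 < eBeta a b)%E.
Proof.
apply: (@ge0_integral_gt0 _ 0 1); [exact: ltr01|by []|by move=> t; rewrite lee_fin|].
move=> t /andP[t0 t1].
by rewrite lte_fin mulr_gt0// ppow_gt0E ?powR_gt0// subr_gt0.
Qed.

(* Substitute z = x + y in the double integral, exchange the integrations, then
   substitute x = z v; all parameters are allowed, both sides being possibly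
   infinite. *)
Lemma eBetaGamma a b : (eGamma a * eGamma b = eBeta a b * eGamma (a + b))%E.
Proof.
pose F (xz : measurableTypeR R * measurableTypeR R) : R :=
  ppow (a - 1) xz.1 * (ppow (b - 1) (xz.2 - xz.1) * expR (- xz.2)).
have F0 xz : 0 <= F xz by rewrite /F !mulr_ge0 ?ppow_ge0 ?expR_ge0.
have mF : measurable_fun setT F.
  apply: measurable_funM.
    by apply: measurableT_comp; first exact: measurable_ppow.
  apply: measurable_funM; last exact: measurable_expRN.
  by apply: measurableT_comp; [exact: measurable_ppow|exact: measurable_funB].
have mF1 x : measurable_fun setT (fun z => F (x, z)).
  by apply: measurableT_comp.
have mF2 z : measurable_fun setT (fun x => F (x, z)).
  by apply: measurableT_comp.
have E1 x : (\int[leb]_z (F (x, z))%:E =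
    (ppow (a - 1) x * expR (- x))%:E * eGamma b)%E.
  rewrite -(@ge0_integralZl _ _ _ leb _ measurableT _ (measurable_gammai b)); last 2 first.
  - by move=> t _; rewrite lee_fin.
  - by rewrite lee_fin.
  pose g y : \bar R := ((ppow (a - 1) x * expR (- x))%:E *
    (ppow (b - 1) y * expR (- y))%:E)%E.
  have := @ge0_integral_affine _ 1 (- x) g ltr01.
  rewrite invr1 mul1e => <-.
  - apply: eq_integral => z _; rewrite /g /F/= mul1r -EFinM; congr EFin.
    have -> : - z = - x + - (z - x) by ring.
    by rewrite expRD; ring.
  - by apply: measurable_funeM.
  - by move=> y; rewrite /g -EFinM lee_fin mulr_ge0.
have E2 z : (\int[leb]_x (F (x, z))%:E =
    eBeta a b * (ppow (a + b - 1) z * expR (- z))%:E)%E.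
  have [z0|z0] := ltP 0 z; last first.
    rewrite (ppow_le0E _ z0) mul0r mule0; apply: integral0_eq => y _.
    rewrite /F/=; have [x0|x0] := ltP 0 y; last by rewrite (ppow_le0E _ x0) mul0r.
    by rewrite (@ppow_le0E _ _ (z - y)) ?mul0r ?mulr0// subr_le0 (le_trans z0)// ltW.
  have zE : z * z `^ (a - 1) * z `^ (b - 1) = z `^ (a + b - 1).
    have zn0 (q : R) : (q == 0) ==> (z != 0) by rewrite (gt_eqF z0) implybT.
    have z1 : z = z `^ 1 by rewrite powRr1// ltW.
    rewrite {1}z1 -(powRD (zn0 _)) -(powRD (zn0 _)).
    by congr (powR _ _); ring.
  have mFz : measurable_fun setT (fun x => (F (x, z))%:E) by exact/measurable_EFinP.
  have Fz0 y : (0 <= (F (y, z))%:E)%E by rewrite lee_fin.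
  have := ge0_integral_affine 0 z0 mFz Fz0.
  have -> : (\int[leb]_x (F ((z * x + 0)%R, z))%:E =
      (z `^ (a - 1) * z `^ (b - 1) * expR (- z))%:E * eBeta a b)%E.
    rewrite -(@ge0_integralZl _ _ _ leb _ measurableT _ (measurable_betai a b)).
    - apply: eq_integral => v _; rewrite /F/= addr0 -EFinM; congr EFin.
      by rewrite (_ : z - z * v = z * (1 - v)) ?ppowZ//; ring.
    - by move=> t _; rewrite lee_fin.
    - by rewrite lee_fin !mulr_ge0 ?powR_ge0 ?expR_ge0.
  move=> /(congr1 (fun u : \bar R => z%:E * u)%E).
  rewrite !muleA -!EFinM mulfV ?gt_eqF// mul1e => <-.
  rewrite muleC; congr (_ * _%:E)%E.
  by rewrite (ppow_gt0E _ z0) -zE; ring.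
transitivity (\int[leb]_x \int[leb]_z (F (x, z))%:E)%E.
  under [RHS]eq_integral do rewrite E1.
  rewrite (@ge0_integralZr _ _ _ leb _ measurableT _ (measurable_gammai a))//.
    by move=> x _; rewrite lee_fin.
  exact: eGamma_ge0.
transitivity (\int[leb]_z \int[leb]_x (F (x, z))%:E)%E.
  apply: (@fubini_tonelli _ _ _ _ _ leb leb (EFin \o F)).
    exact/measurable_EFinP.
  by move=> xz; rewrite lee_fin.
under eq_integral do rewrite E2.
rewrite (@ge0_integralZl _ _ _ leb _ measurableT _ (measurable_gammai (a + b)))//.
  by move=> x _; rewrite lee_fin.
exact: ltW (eBeta_gt0 _ _).
Qed.

Lemma eBetaa1 a : 0 < a -> eBeta a 1 = (a^-1)%:E.
Proof.
move=> a0; rewrite -integral_powR01//.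
rewrite -(@integral_itv_bndo_bndc _ (BRight 0) 1); last first.
  by apply/measurable_EFinP; apply: measurable_funTS; exact: measurable_powR.
rewrite [in RHS]integral_mkcond; apply: eq_integral => t _.
rewrite patchE mem_setE in_itv/= /ppow subrr subr_gt0 powRr0.
by case: ltP => t0; case: ltP => t1; rewrite ?(mulr0, mul0r, mulr1).
Qed.

Lemma eGamma1 : eGamma 1 = 1%E.
Proof.
rewrite -(@integral_exponential_pdf R 1)// /eGamma.
under eq_integral do rewrite mulrC.
rewrite integral_mulppow integral_itv_obnd_cbnd; last first.
  apply/measurable_EFinP/measurable_funTS/measurable_funM.
    exact: measurable_expRN.
  exact: measurable_powR.
rewrite integral_mkcond; apply: eq_integral => t _.
rewrite patchE /exponential_pdf patchE; case: ifPn => // _.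
by rewrite subrr powRr0 mulr1 mul1r mulN1r.
Qed.

(** The functional equation is the case b = 1 of the Beta identity, in which the Beta integral is
    1/a. *)
Lemma eGammaS a : 0 < a -> eGamma (a + 1) = (a%:E * eGamma a)%E.
Proof.
move=> a0; have := eBetaGamma a 1; rewrite eGamma1 eBetaa1// mule1 => ->.
by rewrite muleA -EFinM mulfV ?mul1e// gt_eqF.
Qed.

Let eGamma_natS n : (eGamma n.+1%:R < +oo)%E.
Proof.
elim: n => [|n IH]; first by rewrite eGamma1 ltry.
rewrite -natr1 eGammaS ?ltr0n//.
by rewrite lte_mul_pinfty ?lee_fin.
Qed.

(** The functional equation reduces s to p = s + 1 >= 1. If n <= p < n + 1, then t^(p-1) is at most
    t^(n-1) + t^n: the second term dominates for t >= 1, the first for t <= 1. Integer arguments are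
    finite by induction. *)
Lemma eGamma_fin s : 0 < s -> eGamma s \is a fin_num.
Proof.
move=> s0; rewrite ge0_fin_numE ?eGamma_ge0//.
suff S1 p : 1 <= p -> (eGamma p < +oo)%E.
  have := S1 (s + 1); rewrite eGammaS// lerDr => /(_ (ltW s0)).
  case: (eGamma s) (eGamma_ge0 s) => [r _ _|_|//].
    exact: ltry.
  by rewrite gt0_muley ?lte_fin// ltxx.
move=> p1; pose n := Num.truncn p.
have /andP[np pn] : n%:R <= p < n.+1%:R by apply: truncn_itv; exact: le_trans p1.
have n0 : (0 < n)%N by rewrite truncn_gt0.
apply: (@le_lt_trans _ _ (eGamma n%:R + eGamma n.+1%:R)%E); last first.
  by rewrite lte_add_pinfty// -(prednK n0).
have g0 q (t : R) : [set: R] t -> (0 <= (ppow (q - 1) t * expR (- t))%:E)%E.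
  by rewrite lee_fin.
have := ge0_integralD leb measurableT (g0 n%:R) (measurable_gammai n%:R)
  (g0 n.+1%:R) (measurable_gammai n.+1%:R).
rewrite -/(eGamma _) -/(eGamma _) => <-.
apply: ge0_le_integral; [by []|exact: g0|exact: measurable_gammai| |].
  by apply: emeasurable_funD; exact: measurable_gammai.
move=> t _; rewrite -EFinD lee_fin -mulrDl ler_wpM2r ?expR_ge0// /ppow.
case: ifPn => [t0|]; last by rewrite addr0.
have [t1|t1] := leP 1 t.
  rewrite ler_wpDl ?powR_ge0// ler_powR//.
  by rewrite -natr1 addrK lerBlDr natr1 ltW.
have t01 : 0 < t <= 1 by rewrite t0 ltW.
by rewrite ler_wpDr ?powR_ge0// (ger_powR t01)// lerD2r.
Qed.

Lemma GammaEE s : 0 < s -> (Gamma s)%:E = eGamma s.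
Proof. by move=> s0; rewrite GammaE fineK// eGamma_fin. Qed.

Lemma Gamma_gt0 s : 0 < s -> 0 < Gamma s :> R.
Proof. by move=> s0; rewrite -lte_fin GammaEE// eGamma_gt0. Qed.

Lemma GammaS s : 0 < s -> Gamma (s + 1) = s * Gamma s :> R.
Proof.
move=> s0; apply: EFin_inj; rewrite EFinM !GammaEE ?addr_gt0//.
exact: eGammaS.
Qed.

(** An infinite Beta integral would make its product with the positive Gamma(a+b) infinite, whereas
    that product is the finite Gamma(a) Gamma(b). *)
Lemma eBetaE a b : 0 < a -> 0 < b ->
  eBeta a b = (Gamma a * Gamma b / Gamma (a + b))%:E.
Proof.
move=> a0 b0; have G0 : 0 < Gamma (a + b) :> R by rewrite Gamma_gt0// addr_gt0.
have := eBetaGamma a b; rewrite -!GammaEE ?addr_gt0//.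
case: (eBeta a b) (eBeta_gt0 a b) => [r _| |]//.
  rewrite -!EFinM => -[->]; congr EFin; rewrite mulfK// gt_eqF//.
by rewrite gt0_mulye ?lte_fin.
Qed.

End gamma.

(** * Lebesgue measure on R^d *)

Section space.
Context {R : realType}.
Local Notation leb := (@lebesgue_measure R).

Lemma ge0_integral_lebesgue_cons d (f : Rn R d.+1 -> \bar R) :
  measurable_fun setT f -> (forall x, 0 <= f x)%E ->
  (\int[lebesgue_n R d.+1]_x f x =
   \int[leb]_t \int[lebesgue_n R d]_y f (Rn_cons (t, y)))%E.
Proof.
move=> mf f0.
have := @ge0_integral_pushforward _ _ _ _ _ _ (@measurable_Rn_cons R d)
  (leb \x lebesgue_n R d)%E _ f measurableT mf (fun x _ => f0 x).
rewrite preimage_setT => ->.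
rewrite (@fubini_tonelli1 _ _ _ _ _ _ _ (f \o @Rn_cons R d))//.
  by apply: measurableT_comp => //; exact: measurable_Rn_cons.
by move=> x; exact: f0.
Qed.

Definition scaleRn d (c : R) (x : Rn R d) : Rn R d := [tuple c * tnth x i | i < d].

Lemma measurable_scaleRn d c : measurable_fun setT (@scaleRn d c).
Proof.
apply/measurable_fun_tnthP => i.
rewrite (_ : _ \o _ = fun x => c * tnth x i); last first.
  by apply/funext => x; rewrite /= tnth_mktuple.
by apply: measurable_funM => //; exact: measurable_tnth.
Qed.

Lemma scaleRn_cons d c t (y : Rn R d) :
  scaleRn c (Rn_cons (t, y)) = Rn_cons (c * t, scaleRn c y).
Proof.
apply: eq_from_tnth => i; rewrite tnth_mktuple.
have [j ->|->] := unliftP ord0 i; last by rewrite !tnth0.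
by rewrite !tnthS tnth_mktuple.
Qed.

Lemma ge0_integral_scaleRn d (c : R) (f : Rn R d -> \bar R) : 0 < c ->
  measurable_fun setT f -> (forall x, 0 <= f x)%E ->
  (\int[lebesgue_n R d]_x f (scaleRn c x) =
   ((c ^+ d)^-1)%:E * \int[lebesgue_n R d]_x f x)%E.
Proof.
move=> c0; elim: d f => [f mf f0|d IH f mf f0].
  rewrite expr0 invr1 mul1e; apply: eq_integral => x _.
  by congr f; apply/eq_from_tnth; case.
have mcons t : measurable_fun setT (fun y => f (Rn_cons (t, y))).
  apply: measurableT_comp => //; apply: measurableT_comp => //.
  exact: measurable_Rn_cons.
rewrite ge0_integral_lebesgue_cons//; last first.
  by apply: measurableT_comp => //; exact: measurable_scaleRn.
have E t : (\int[lebesgue_n R d]_y f (scaleRn c (Rn_cons (t, y))) =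
    (c ^+ d)^-1%:E * \int[lebesgue_n R d]_y f (Rn_cons ((c * t)%R, y)))%E.
  rewrite -IH//; first by apply: eq_integral => y _; rewrite scaleRn_cons.
have mG : measurable_fun setT (fun t => \int[lebesgue_n R d]_y f (Rn_cons (t, y)))%E.
  apply: (@measurable_fun_fubini_tonelli_F _ _ _ _ _ _ (f \o @Rn_cons R d)).
    by apply: measurableT_comp => //; exact: measurable_Rn_cons.
  by move=> x; exact: f0.
have G0 t : (0 <= \int[lebesgue_n R d]_y f (Rn_cons (t, y)))%E.
  by apply: integral_ge0.
under eq_integral do rewrite E.
have H : (\int[leb]_t \int[lebesgue_n R d]_y f (Rn_cons ((c * t)%R, y)) =
    c^-1%:E * \int[leb]_t \int[lebesgue_n R d]_y f (Rn_cons (t, y)))%E.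
  rewrite -(ge0_integral_affine 0 c0 mG G0).
  by apply: eq_integral => t _; rewrite addr0.
rewrite ge0_integralZl//; last 2 first.
    by apply: (measurableT_comp mG); exact: measurable_funM.
  by rewrite lee_fin invr_ge0 exprn_ge0// ltW.
rewrite H -ge0_integral_lebesgue_cons// muleA -EFinM; congr (_%:E * _)%E.
by rewrite exprSr invfM mulrC.
Qed.

(** Integrability and value share one induction: Fubini for signed integrands requires the
    integrability of the product, which Tonelli reduces to that of the head and of the tail. *)
Lemma integral_prodRn d (f : 'I_d -> R -> R) :
  (forall i, leb.-integrable setT (EFin \o f i)) ->
  (lebesgue_n R d).-integrable setT (fun x => (\prod_i f i (tnth x i))%:E) /\
  (\int[lebesgue_n R d]_x (\prod_i f i (tnth x i))%:E =
    (\prod_i \int[leb]_t f i t)%:E)%E.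
Proof.
elim: d f => [f _|d IH f intf].
  have E : (fun x : Rn R 0 => (\prod_i f i (tnth x i))%:E) = cst 1%E.
    by apply/funext => x; rewrite big_ord0.
  rewrite !E big_ord0; split; last first.
    by rewrite integral_dirac//= diracT mul1e.
  apply/integrableP; split => //.
  by rewrite integral_dirac//= diracT mul1e/= normr1 ltry.
have [intg Eg] := IH (fun i => f (lift ord0 i)) (fun i => intf _).
pose g (y : Rn R d) : R := \prod_i f (lift ord0 i) (tnth y i).
have fE t (y : Rn R d) : \prod_i f i (tnth (Rn_cons (t, y)) i) = f ord0 t * g y.
  rewrite big_ord_recl tnth0; congr (_ * _); apply: eq_bigr => i _.
  by rewrite tnthS.
have mf0 : measurable_fun setT (f ord0).
  by apply/measurable_EFinP; exact: measurable_int (intf ord0).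
have mg : measurable_fun setT g.
  by apply/measurable_EFinP; exact: measurable_int intg.
pose F (z : measurableTypeR R * Rn R d) : \bar R := (f ord0 z.1 * g z.2)%:E.
have mF : measurable_fun setT F.
  apply/measurable_EFinP/measurable_funM.
    by apply: (measurableT_comp mf0).
  by apply: (measurableT_comp mg).
have intF : (leb \x lebesgue_n R d)%E.-integrable setT F.
  apply/integrable12ltyP => //.
  under eq_integral => t _.
    under eq_integral do rewrite /F/= normrM EFinM.
    rewrite ge0_integralZl//; first over.
    by apply/measurable_EFinP; exact: measurableT_comp.
  rewrite /= ge0_integralZr//.
  - rewrite lte_mul_pinfty//.
    + exact: integral_ge0.
    + by rewrite ge0_fin_numE ?integral_ge0//; have /integrableP[] := intf ord0.
    + by have /integrableP[] := intg.
  - by apply/measurable_EFinP; exact: measurableT_comp.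
  - by apply: integral_ge0.
pose G (x : Rn R d.+1) := (\prod_i f i (tnth x i))%:E.
have mG : measurable_fun setT G.
  apply/measurable_EFinP; apply: measurable_prod => i _.
  apply: measurableT_comp; last exact: measurable_tnth.
  by apply/measurable_EFinP; exact: measurable_int (intf i).
have GF : G \o @Rn_cons R d = F.
  by apply/funext => -[t y]; rewrite /G/= fE.
have intGF : (leb \x lebesgue_n R d)%E.-integrable (@Rn_cons R d @^-1` setT) (G \o @Rn_cons R d).
  by rewrite preimage_setT GF.
split; first exact: (integrable_pushforward (@measurable_Rn_cons R d) mG intGF).
have := integral_pushforward (@measurable_Rn_cons R d) mG intGF measurableT.
rewrite preimage_setT GF => ->.
rewrite -integral12_prod_meas1//.
rewrite big_ord_recl.
set c := \prod_(i < d) _.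
have EF t : (\int[lebesgue_n R d]_y F (t, y) = c%:E * (f ord0 t)%:E)%E.
  have -> : c%:E = (\int[lebesgue_n R d]_y (g y)%:E)%E by rewrite Eg.
  by rewrite muleC -integralZl.
under eq_integral do rewrite /fubini_F EF.
rewrite (integralZl measurableT (intf ord0)) EFinM muleC; congr (_ * _)%E.
rewrite /Rintegral fineK//; exact: (integrable_fin_num measurableT (intf _)).
Qed.

End space.

Section sqnorm.
Context {R : realType} {d : nat}.
Implicit Types (x : Rn R d).

(** The radial variable throughout is t = |x|^2 rather than |x|: it is polynomial in x and is what
    enters q(2|x|^2 - 1). *)
Definition sqnorm x : R := \sum_i tnth x i ^+ 2.

Lemma sqnorm_ge0 x : 0 <= sqnorm x.
Proof. by apply: sumr_ge0 => i _; exact: sqr_ge0. Qed.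

Lemma enorm_sqr x : enorm x ^+ 2 = sqnorm x.
Proof. by rewrite sqr_sqrtr// sqnorm_ge0. Qed.

Lemma measurable_sqnorm : measurable_fun setT sqnorm.
Proof.
by apply: measurable_sum => i; apply: measurable_funX; exact: measurable_tnth.
Qed.

Lemma sqnormZ c x : sqnorm (scaleRn c x) = c ^+ 2 * sqnorm x.
Proof.
by rewrite /sqnorm mulr_sumr; apply: eq_bigr => i _; rewrite tnth_mktuple exprMn.
Qed.

End sqnorm.

(** * Zero sets of polynomials *)

Section null.
Context {R : realType}.
Local Notation leb := (@lebesgue_measure R).

Lemma finite_set_root (c : {poly R}) : c != 0 -> finite_set [set t | root c t].
Proof.
have [n] := ubnP (size c); elim: n c => // n IH c; rewrite ltnS => cn c0.
have [[a ca]|nroot] := pselect (exists a, root c a); last first.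
  rewrite (_ : [set _ | _] = set0)//; apply/seteqP; split => // t ct.
  by apply: nroot; exists t.
have /factor_theorem[q cE] := ca.
have q0 : q != 0 by apply: contra c0; rewrite cE => /eqP ->; rewrite mul0r.
apply: (@sub_finite_set _ _ ([set a] `|` [set t | root q t])).
  move=> t /=; rewrite cE rootM root_XsubC => /orP[qt|/eqP ->]; [by right|by left].
rewrite finite_setU; split=> //; apply: IH => //.
by move: cn; rewrite cE size_Mmonic ?monicXsubC// size_XsubC addn2.
Qed.

Lemma measurable_mpeval d (p : mpoly d R) : measurable_fun setT (mpeval p).
Proof.
rewrite (_ : mpeval p = fun x => \sum_(m <- msupp p) mcoeff m p * \prod_i tnth x i ^+ m i).
  apply: measurable_sum => m; apply: measurable_funM => //.
  apply: measurable_prod => i _; apply: measurable_funX; exact: measurable_tnth.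
by apply/funext => x; rewrite /mpeval mevalE.
Qed.

Definition mnm_tail d (m : multinom d.+1) : multinom d :=
  Multinom [tuple m (lift ord0 i) | i < d].

Definition mpoly_slice d (t : R) (p : mpoly d.+1 R) : mpoly d R :=
  \sum_(m <- msupp p) (mcoeff m p * t ^+ m ord0) *: mpolyX R (mnm_tail m).

Lemma mpeval_slice d t (p : mpoly d.+1 R) (y : Rn R d) :
  mpeval (mpoly_slice t p) y = mpeval p (Rn_cons (t, y)).
Proof.
rewrite /mpeval [in RHS]mevalE /mpoly_slice raddf_sum/=; apply: eq_bigr => m _.
rewrite mevalZ mevalX big_ord_recl tnth0 -mulrA; congr (_ * (_ * _)).
by apply: eq_bigr => i _; rewrite tnthS mnmE.
Qed.

(** Regard p as a polynomial in the last d variables over R[t]. Then [c] is its coefficient at the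
    tail of the leading monomial, and a slice vanishes only where all these coefficients do. *)
Lemma mpoly_slice_eq0 d (p : mpoly d.+1 R) : p != 0 ->
  exists2 c : {poly R}, c != 0 & forall t, mpoly_slice t p = 0 -> root c t.
Proof.
move=> p0; pose m0 := mlead p; have m0p : m0 \in msupp p := mlead_supp p0.
pose c := \sum_(m <- msupp p | mnm_tail m == mnm_tail m0)
  mcoeff m p *: 'X^(m ord0) : {poly R}.
exists c; last first.
  move=> t /(congr1 (mcoeff (mnm_tail m0))); rewrite mcoeff0 => pt0.
  apply/rootP; rewrite -[RHS]pt0 /c /mpoly_slice raddf_sum/= horner_sum.
  rewrite big_mkcond/=; apply: eq_bigr => m _.
  rewrite mcoeffZ mcoeffX; case: ifP => _; last by rewrite mulr0.
  by rewrite mulr1 hornerZ hornerXn.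
(* A monomial is determined by its head exponent and its tail, so this coefficient of [c] is exactly
   that of [m0] in p. *)
apply/eqP => /(congr1 (fun q : {poly R} => q`_(m0 ord0))).
rewrite coef0 /c coef_sum big_mkcond (bigD1_seq m0)//= ?msupp_uniq// eqxx.
rewrite coefZ coefXn eqxx mulr1 big1 ?addr0.
  by apply/eqP; rewrite -mcoeff_msupp.
move=> m mm0; case: eqP => // mt; rewrite coefZ coefXn.
case: eqP => [e|]; last by rewrite mulr0.
case/eqP: mm0; apply/mnmP => i.
have [j ->|->] := unliftP ord0 i; last by [].
by move/mnmP: mt => /(_ j); rewrite !mnmE.
Qed.

(** Induction on d with Tonelli: apart from finitely many t, the slice at t is a nonzero polynomial,
    whose zeros form a null set. *)
Lemma mpeval_null d (p : mpoly d R) : p != 0 ->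
  lebesgue_n R d [set x | mpeval p x = 0] = 0%E.
Proof.
have mA n (q : mpoly n R) : measurable [set x | mpeval q x = 0].
  rewrite -[X in measurable X]setTI.
  by apply: (measurable_mpeval q measurableT (measurable_set1 0)).
elim: d p => [p p0|d IH p p0].
  rewrite (_ : [set _ | _] = set0) ?measure0//; apply/seteqP; split => // x/=.
  rewrite (nvar0_mpolyC p) /mpeval mevalC => /eqP.
  by apply/negP; apply: contra p0 => /eqP e; rewrite (nvar0_mpolyC p) e mpolyC0.
have [c c0 croot] := mpoly_slice_eq0 p0.
pose A := [set x | mpeval p x = 0].
have mind : measurable_fun setT (fun x => (\1_A x : R)%:E).
  by apply/measurable_EFinP; exact: measurable_indic (mA _ p).
have -> : lebesgue_n R d.+1 [set x | mpeval p x = 0] = (\int[lebesgue_n R d.+1]_x (\1_A x)%:E)%E.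
  by rewrite integral_indic ?setIT//; exact: mA.
rewrite ge0_integral_lebesgue_cons//.
pose N := [set t | root c t].
have finN : finite_set N := finite_set_root c0.
have N0 : leb N = 0%E by apply: countable_lebesgue_measure0; exact: finite_set_countable.
have mN : measurable N by apply: countable_measurable => //; exact: finite_set_countable.
rewrite (ae_eq_integral (cst 0%E))//.
- by rewrite integral0.
- apply: (@measurable_fun_fubini_tonelli_F _ _ _ _ _ _
    ((fun x => (\1_A x : R)%:E) \o @Rn_cons R d)) => //.
    by apply: (measurableT_comp mind); exact: measurable_Rn_cons.
  by move=> x; rewrite /= lee_fin.
- exists N; split => // t /= /not_implyP[_] tA; apply: contrapT => Nt; apply: tA.
  have pt0 : mpoly_slice t p != 0.
    by apply/eqP => /croot ct; exact: Nt.
  transitivity (\int[lebesgue_n R d]_y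
      (\1_[set y | mpeval (mpoly_slice t p) y = 0] y)%:E)%E; last first.
    by rewrite integral_indic ?setIT//; [exact: IH|exact: mA].
  apply: eq_integral => y _; congr EFin; rewrite !indicE; congr (_ _)%:R.
  by rewrite /A; apply/idP/idP; rewrite !inE/= mpeval_slice.
Qed.

Lemma normsq_neq0 d : (0 < d)%N -> normsq_poly != 0 :> mpoly d R.
Proof.
move=> d0; apply/eqP => /(congr1 (meval (fun=> 1))).
rewrite raddf0 /normsq_poly raddf_sum/=.
under eq_bigr do rewrite rmorphXn/= mevalXU expr1n.
by rewrite sumr_const card_ord => /eqP; rewrite pnatr_eq0 -leqn0 leqNgt d0.
Qed.

Lemma sqnorm_null d : (0 < d)%N -> lebesgue_n R d [set x | sqnorm x = 0] = 0%E.
Proof.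
move=> d0; have -> : [set x : Rn R d | sqnorm x = 0] = [set x | mpeval normsq_poly x = 0].
  by apply/seteqP; split => x /=; rewrite mpeval_normsq enorm_sqr.
exact/mpeval_null/normsq_neq0.
Qed.

End null.

(** * Polar integration *)

(** As a function of |x|^2 this is the radial profile of the unit ball; it serves to identify the
    constant of polar integration. *)
Definition cut1 {R : realType} (t : R) : R := if t <= 1 then 1 else 0.

Lemma cut1_ge0 {R : realType} (t : R) : 0 <= cut1 t.
Proof. by rewrite /cut1; case: ifP. Qed.

Lemma measurable_cut1 {R : realType} : measurable_fun setT (@cut1 R).
Proof. by apply: measurable_fun_ifT => //; exact: measurable_fun_ler. Qed.

Section radial.
Context {R : realType} {disp : measure_display} {T : measurableType disp}.
Variables (L : {sigma_finite_measure set T -> \bar R}) (d : nat)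
  (N : T -> R) (S : R -> T -> T).
Local Notation leb := (@lebesgue_measure R).
Implicit Types (x y : T) (h : T -> R).

(* What polar integration needs from R^d: dilations [S c], c > 0, that multiply
   the measure by c^d and the squared norm [N] by c^2. *)
Record is_radial : Prop := IsRadial {
  rad_mN : measurable_fun setT N;
  rad_N0 : forall x, 0 <= N x;
  rad_null : L [set x | N x = 0] = 0%E;
  rad_mS : forall c, measurable_fun setT (S c);
  rad_NS : forall c x, N (S c x) = c ^+ 2 * N x;
  rad_int : forall c (f : T -> \bar R), 0 < c -> measurable_fun setT f ->
    (forall x, 0 <= f x)%E ->
    (\int[L]_x f (S c x) = ((c ^+ d)^-1)%:E * \int[L]_x f x)%E }.

Hypothesis H : is_radial.

(** Only positive dilations are considered, so that |h| and the positive and negative parts of h are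
    homogeneous along with h. *)
Definition homogeneous (k : nat) (h : T -> R) :=
  forall c x, 0 < c -> h (S c x) = c ^+ k * h x.

Section nonneg.
Variables (k : nat) (h : T -> R).
Hypotheses (d0 : (0 < d)%N) (mh : measurable_fun setT h)
  (h0 : forall x, 0 <= h x) (homh : homogeneous k h).

(** With t = r^2 one has r^(k+d-1) dr = t^(p-1) dt / 2. *)
Let p : R := (k + d)%:R / 2.

Let p0 : 0 < p.
Proof. by rewrite divr_gt0// ltr0n addn_gt0 d0 orbT. Qed.

(** What is left of h(x) / N x after the dilation x = sqrt t y: the condition t <= N x turns into 1
    <= N y. *)
Let w y : R := if 1 <= N y then h y * ppow (- 1) (N y) else 0.

Let w_ge0 y : 0 <= w y.
Proof. by rewrite /w; case: ifP => // _; rewrite mulr_ge0 ?ppow_ge0. Qed.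

Let measurable_w : measurable_fun setT w.
Proof.
apply: measurable_fun_ifT => //.
  by apply: measurable_fun_ler => //; exact: rad_mN H.
apply: measurable_funM => //.
by apply: measurableT_comp; [exact: measurable_ppow|exact: rad_mN H].
Qed.

(* Insert 1 = (N x)^-1 \int_(0 < t <= N x) dt, integrate first in x after the
   dilation x = sqrt t y, and then in t after the dilation t |-> t / N y. *)
Let radial_gen (phi : R -> R) : measurable_fun setT phi ->
  (forall t, 0 <= phi t) ->
  (\int[L]_x (phi (N x) * h x)%:E =
   \int[L]_y (w y * ppow (- p) (N y))%:E *
   \int[leb]_t (phi t * ppow (p - 1) t)%:E)%E.
Proof.
move=> mphi phi0.
have mN := (rad_mN H).
(* [ppow 0] is the indicator of t > 0, so the last factor restricts t to ]0, N x]. *)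
pose F (xt : T * measurableTypeR R) : R :=
  phi (N xt.1) * h xt.1 * ppow (- 1) (N xt.1) *
  (if xt.2 <= N xt.1 then ppow 0 xt.2 else 0).
have F0 xt : 0 <= F xt.
  by rewrite !mulr_ge0 ?ppow_ge0//; case: ifP; rewrite ?ppow_ge0.
have mN1 : measurable_fun setT (fun xt : T * measurableTypeR R => N xt.1).
  by apply: measurableT_comp.
have mF : measurable_fun setT F.
  apply: measurable_funM; first apply: measurable_funM; first apply: measurable_funM.
  - by apply: measurableT_comp.
  - by apply: measurableT_comp.
  - by apply: measurableT_comp => //; exact: measurable_ppow.
  - apply: measurable_fun_ifT => //; first exact: measurable_fun_ler.
    by apply: measurableT_comp => //; exact: measurable_ppow.
have Ft x : N x != 0 -> (\int[leb]_t (F (x, t))%:E = (phi (N x) * h x)%:E)%E.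
  move=> Nn0; have Nx0 : 0 < N x by rewrite lt_neqAle eq_sym Nn0 (rad_N0 H).
  transitivity (\int[leb]_(t in `]0%R, N x])
      (phi (N x) * h x * ppow (- 1) (N x))%:E)%E.
    rewrite [in RHS]integral_mkcond; apply: eq_integral => t _.
    rewrite patchE mem_setE in_itv/= /F/= [ppow 0 t]/ppow powRr0.
    by case: ltP => t0/=; case: ifP; rewrite ?mulr0 ?mulr1.
  rewrite integral_cst//= lebesgue_measure_itv/= lte_fin Nx0 -EFinB -EFinM.
  rewrite subr0 ppow_gt0E// powR_inv1 ?ltW//; congr EFin.
  by rewrite mulfVK// gt_eqF.
have Fx t : (\int[L]_x (F (x, t))%:E = \int[L]_y
    (w y * (ppow (p - 1) t * phi (t * N y)))%:E)%E.
  have [t0|t0] := ltP 0 t; last first.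
    rewrite !integral0_eq// => y _; rewrite ?(ppow_le0E _ t0) ?mul0r ?mulr0//.
    by rewrite /F/= (ppow_le0E _ t0) if_same mulr0.
  pose s := Num.sqrt t.
  have s0 : 0 < s by rewrite sqrtr_gt0.
  have s2 : s ^+ 2 = t by rewrite sqr_sqrtr// ltW.
  have mFt : measurable_fun setT (fun x => (F (x, t))%:E).
    by apply/measurable_EFinP; exact: measurableT_comp.
  have Ft0 x : (0 <= (F (x, t))%:E)%E by rewrite lee_fin.
  have := rad_int H s0 mFt Ft0.
  have sd0 : 0 < s ^+ d by rewrite exprn_gt0.
  move=> /(congr1 (fun u : \bar R => ((s ^+ d)%:E * u)%E)).
  rewrite muleA -EFinM mulfV ?gt_eqF// mul1e => <-.
  rewrite -ge0_integralZl//; first last.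
  - by rewrite lee_fin ltW.
  - by apply: (measurableT_comp mFt); exact: rad_mS H _.
  apply: eq_integral => y _; rewrite -EFinM; congr EFin.
  rewrite /F/= (rad_NS H) s2 homh// ppowZ// /w.
  have -> : (t <= t * N y) = (1 <= N y) by rewrite ler_pMr.
  case: ifP => N1; last by rewrite !mulr0 mul0r.
  rewrite !(ppow_gt0E _ t0) powRr0.
  (* The Jacobian gives s^d, homogeneity of h gives s^k, and the inserted 1/N x gives 1/t. *)
  have -> : t `^ (p - 1) = s ^+ d * s ^+ k * t `^ (- 1).
    rewrite -exprD /s -powR12_sqrt ?(ltW t0)// -powR_mulrn ?powR_ge0// -powRrM.
    rewrite -powRD ?(gt_eqF t0) ?implybT//; congr (powR _ _).
    by rewrite /p addnC mulrC.
  ring.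
transitivity (\int[L]_x \int[leb]_t (F (x, t))%:E)%E.
  apply: ge0_ae_eq_integral => //.
  - apply/measurable_EFinP; apply: measurable_funM => //.
    by apply: measurableT_comp => //; exact: rad_mN H.
  - by apply: (@measurable_fun_fubini_tonelli_F _ _ _ _ _ leb (EFin \o F));
      [exact/measurable_EFinP|move=> xt; rewrite /= lee_fin].
  - by move=> x _; rewrite lee_fin mulr_ge0.
  - by move=> x _; apply: integral_ge0 => t _; rewrite lee_fin.
  (* Where N x = 0 the inserted factor is 0 instead of 1, whence an exceptional null set. *)
  - exists [set x | N x = 0]; split; last 1 first.
    + move=> x /= /not_implyP[_ neF]; apply: contrapT => /eqP Nx.
      by apply: neF; rewrite Ft.
    + by rewrite -[X in measurable X]setTI; exact: (rad_mN H measurableT (measurable_set1 0)).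
    + exact: rad_null H.
rewrite (@fubini_tonelli _ _ _ _ _ L leb (EFin \o F))//; last first.
  exact/measurable_EFinP.
under eq_integral do rewrite Fx.
pose G (ty : measurableTypeR R * T) : R :=
  w ty.2 * (ppow (p - 1) ty.1 * phi (ty.1 * N ty.2)).
rewrite (@fubini_tonelli _ _ _ _ _ leb L (EFin \o G))//; last 2 first.
- apply/measurable_EFinP; apply: measurable_funM; first exact: measurableT_comp.
  apply: measurable_funM.
    by apply: measurableT_comp => //; exact: measurable_ppow.
  apply: measurableT_comp => //; apply: measurable_funM => //.
  exact: measurableT_comp.
- by move=> ty; rewrite lee_fin !mulr_ge0 ?ppow_ge0.
pose M := (\int[leb]_t (phi t * ppow (p - 1) t)%:E)%E.
have mphip : measurable_fun setT (fun t => (phi t * ppow (p - 1) t)%:E).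
  by apply/measurable_EFinP; apply: measurable_funM => //; exact: measurable_ppow.
have phip0 t : (0 <= (phi t * ppow (p - 1) t)%:E)%E.
  by rewrite lee_fin mulr_ge0 ?ppow_ge0.
have Gy y : (\int[leb]_t (G (t, y))%:E = (w y * ppow (- p) (N y))%:E * M)%E.
  rewrite /G/= /w; case: ifP => N1; last first.
    by rewrite mul0r mul0e; apply: integral0_eq => t _; rewrite mul0r.
  have N0 : 0 < N y := lt_le_trans ltr01 N1.
  have := ge0_integral_affine 0 N0 mphip phip0.
  move=> /(congr1 (fun u : \bar R =>
    ((w y * ppow (- p) (N y) * N y)%:E * u)%E)).
  rewrite muleA -EFinM mulfK ?gt_eqF// -/M /w N1 => <-.
  rewrite -ge0_integralZl//; first last.
  - by rewrite lee_fin !mulr_ge0 ?ppow_ge0// ltW.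
  - by apply: (measurableT_comp mphip); apply: measurable_funD => //; exact: measurable_funM.
  apply: eq_integral => t _.
  rewrite -EFinM addr0 ppowZ// (ppow_gt0E _ N0) (ppow_gt0E _ N0); congr EFin.
  have e1 : N y `^ (- p) * N y * N y `^ (p - 1) = 1.
    rewrite -{2}(powRr1 (ltW N0)) -!powRD ?(gt_eqF N0) ?implybT//.
    have key (q : R) : - q + 1 + (q - 1) = 0 by ring.
    by rewrite key powRr0.
  rewrite (mulrC t); set a := N y `^ (- p) in e1 *; set b := _ `^ (p - 1) in e1 *.
  set v := h y * _; set u := phi _; set q := ppow _ t.
  by transitivity (v * (q * u) * (a * N y * b)); [rewrite e1 mulr1|ring].
transitivity (\int[L]_y ((w y * ppow (- p) (N y))%:E * M))%E.
  by apply: eq_integral => y _; rewrite /= Gy.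
rewrite ge0_integralZr//.
- apply/measurable_EFinP/measurable_funM => //.
  by apply: measurableT_comp => //; exact: measurable_ppow.
- by move=> y _; rewrite lee_fin mulr_ge0 ?ppow_ge0.
- by apply: integral_ge0.
Qed.

(** The first factor in [radial_gen] does not depend on phi. The choice phi = [cut1], for which the
    integral in t is 1/p, shows it to be p times the integral of h over the ball. *)
Lemma radial_integral (phi : R -> R) : measurable_fun setT phi ->
  (forall t, 0 <= phi t) ->
  (\int[L]_x (phi (N x) * h x)%:E =
   p%:E * \int[L]_x (cut1 (N x) * h x)%:E *
   \int[leb]_t (phi t * ppow (p - 1) t)%:E)%E.
Proof.
move=> mphi phi0; rewrite radial_gen//; congr (_ * _)%E.
rewrite (radial_gen measurable_cut1 (@cut1_ge0 R)).
have -> : (\int[leb]_t (cut1 t * ppow (p - 1) t)%:E = p^-1%:E)%E.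
  rewrite -integral_powR01// [in RHS]integral_mkcond; apply: eq_integral => t _.
  rewrite patchE mem_setE in_itv/= /cut1 /ppow.
  by case: (0 < t); case: (t <= 1); rewrite /= ?(mul0r, mul1r, mulr0).
by rewrite muleC -muleA -EFinM mulVf ?mule1// gt_eqF.
Qed.

End nonneg.

Section signed.
Variables (k : nat) (d0 : (0 < d)%N).

Let p : R := (k + d)%:R / 2.

Definition ball_part (h : T -> R) x : R := cut1 (N x) * h x.

Lemma measurable_ball_part h : measurable_fun setT h ->
  measurable_fun setT (ball_part h).
Proof.
move=> mh; apply: measurable_funM => //.
by apply: measurableT_comp; [exact: measurable_cut1|exact: rad_mN H].
Qed.

Lemma homogeneous_norm h : homogeneous k h -> homogeneous k (fun x => `|h x|).
Proof.
by move=> hh c x c0; rewrite hh// normrM ger0_norm// exprn_ge0// ltW.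
Qed.

Lemma homogeneous_pos h : homogeneous k h -> homogeneous k h^\+%R.
Proof.
move=> hh c x c0; rewrite /funrpos hh// maxr_pMr ?mulr0//.
by rewrite exprn_ge0// ltW.
Qed.

Lemma homogeneous_neg h : homogeneous k h -> homogeneous k h^\-%R.
Proof.
move=> hh c x c0; rewrite /funrneg hh// maxr_pMr ?mulr0 ?mulrN//.
by rewrite exprn_ge0// ltW.
Qed.

(** The nonnegative formula for |phi| and |h| computes the integral of the absolute value. *)
Lemma radial_integrable (h : T -> R) (phi : R -> R) :
  measurable_fun setT h -> homogeneous k h ->
  L.-integrable setT (EFin \o ball_part h) ->
  measurable_fun setT phi ->
  leb.-integrable setT (fun t => (phi t * ppow (p - 1) t)%:E) ->
  L.-integrable setT (fun x => (phi (N x) * h x)%:E).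
Proof.
move=> mh hh /integrableP[_ ih] mphi /integrableP[_ iphi].
apply/integrableP; split.
  apply/measurable_EFinP/measurable_funM => //.
  by apply: measurableT_comp => //; exact: rad_mN H.
under eq_integral do rewrite /= normrM.
have mnphi : measurable_fun setT (fun t => `|phi t|) by exact: measurableT_comp.
have mnh : measurable_fun setT (fun x => `|h x|) by exact: measurableT_comp.
have := @radial_integral k (fun x => `|h x|) d0 mnh (fun x => normr_ge0 _)
  (homogeneous_norm hh) (fun t => `|phi t|) mnphi (fun t => normr_ge0 _).
move=> ->.
rewrite -/p lte_mul_pinfty//.
- rewrite mule_ge0 ?lee_fin ?divr_ge0//; apply: integral_ge0 => x _.
  by rewrite lee_fin mulr_ge0// cut1_ge0.
- rewrite ge0_fin_numE; last first.
    rewrite mule_ge0 ?lee_fin ?divr_ge0//; apply: integral_ge0 => x _.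
    by rewrite lee_fin mulr_ge0// cut1_ge0.
  rewrite lte_mul_pinfty ?lee_fin ?divr_ge0//.
  move: ih; congr (_ < _)%E; apply: eq_integral => x _.
  by rewrite /ball_part/= normrM ger0_norm// cut1_ge0.
- move: iphi; congr (_ < _)%E; apply: eq_integral => t _.
  by rewrite /= normrM [X in _ * X]ger0_norm// ppow_ge0.
Qed.

Let radial_Rintegral_ge0 (h : T -> R) (phi : R -> R) :
  measurable_fun setT h -> homogeneous k h -> (forall x, 0 <= h x) ->
  L.-integrable setT (EFin \o ball_part h) ->
  measurable_fun setT phi -> (forall t, 0 <= phi t) ->
  leb.-integrable setT (fun t => (phi t * ppow (p - 1) t)%:E) ->
  \int[L]_x (phi (N x) * h x) =
  p * (\int[L]_x ball_part h x) * \int[leb]_t (phi t * ppow (p - 1) t).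
Proof.
move=> mh hh h0 ih mphi phi0 iphi.
rewrite /Rintegral (radial_integral d0 mh h0 hh mphi phi0) -/p.
rewrite fineM; first by rewrite fineM//; exact: (integrable_fin_num measurableT ih).
  by rewrite fin_numM//; exact: (integrable_fin_num measurableT ih).
exact: (integrable_fin_num measurableT iphi).
Qed.

(** Both sides are bilinear in phi and h, so the nonnegative case suffices: [step] splits h for a
    fixed profile psi >= 0, and then phi is split. *)
Lemma radial_Rintegral (h : T -> R) (phi : R -> R) :
  measurable_fun setT h -> homogeneous k h ->
  L.-integrable setT (EFin \o ball_part h) ->
  measurable_fun setT phi ->
  leb.-integrable setT (fun t => (phi t * ppow (p - 1) t)%:E) ->
  \int[L]_x (phi (N x) * h x) =
  p * (\int[L]_x ball_part h x) * \int[leb]_t (phi t * ppow (p - 1) t).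
Proof.
have step (h' : T -> R) (psi : R -> R) :
    measurable_fun setT h' -> homogeneous k h' ->
    L.-integrable setT (EFin \o ball_part h') ->
    measurable_fun setT psi -> (forall t, 0 <= psi t) ->
    leb.-integrable setT (fun t => (psi t * ppow (p - 1) t)%:E) ->
    \int[L]_x (psi (N x) * h' x) =
    p * (\int[L]_x ball_part h' x) * \int[leb]_t (psi t * ppow (p - 1) t).
  move=> mh hh ih mpsi psi0 ipsi.
  have bE x : ball_part h'^\+%R x = (ball_part h')^\+%R x.
    by rewrite /ball_part/= /funrpos maxr_pMr ?mulr0// cut1_ge0.
  have bE' x : ball_part h'^\-%R x = (ball_part h')^\-%R x.
    by rewrite /ball_part/= /funrneg maxr_pMr ?mulr0 ?mulrN// cut1_ge0.
  have ip : L.-integrable setT (EFin \o ball_part h'^\+%R).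
    by rewrite (_ : ball_part _ = (ball_part h')^\+%R); [exact: integrable_funrpos|exact/funext].
  have im : L.-integrable setT (EFin \o ball_part h'^\-%R).
    by rewrite (_ : ball_part _ = (ball_part h')^\-%R); [exact: integrable_funrneg|exact/funext].
  have mp : measurable_fun setT h'^\+%R by exact: measurable_funrpos.
  have mm : measurable_fun setT h'^\-%R by exact: measurable_funrneg.
  have hE x : h' x = h'^\+%R x - h'^\-%R x by rewrite -[in LHS](funrposBneg h').
  have -> : \int[L]_x ball_part h' x =
      \int[L]_x ball_part h'^\+%R x - \int[L]_x ball_part h'^\-%R x.
    rewrite -RintegralB//; apply: eq_Rintegral => x _.
    by rewrite /ball_part -mulrBr -hE.
  have -> : \int[L]_x (psi (N x) * h' x) =
      \int[L]_x (psi (N x) * h'^\+%R x) - \int[L]_x (psi (N x) * h'^\-%R x).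
    rewrite -RintegralB//.
    - by apply: eq_Rintegral => x _; rewrite -mulrBr -hE.
    - by apply: radial_integrable => //; exact: homogeneous_pos.
    - by apply: radial_integrable => //; exact: homogeneous_neg.
  rewrite (radial_Rintegral_ge0 mp (homogeneous_pos hh) (funrpos_ge0 _) ip mpsi psi0 ipsi).
  rewrite (radial_Rintegral_ge0 mm (homogeneous_neg hh) (funrneg_ge0 _) im mpsi psi0 ipsi).
  by ring.
move=> mh hh ih mphi iphi.
have pE (t : R) : phi^\+%R t * ppow (p - 1) t = (fun t => phi t * ppow (p - 1) t)^\+%R t.
  by rewrite /funrpos maxr_pMl ?mul0r// ppow_ge0.
have mE (t : R) : phi^\-%R t * ppow (p - 1) t = (fun t => phi t * ppow (p - 1) t)^\-%R t.
  by rewrite /funrneg maxr_pMl ?mul0r ?mulNr// ppow_ge0.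
have ip : leb.-integrable setT (fun t => (phi^\+%R t * ppow (p - 1) t)%:E).
  under eq_fun do rewrite pE.
  exact: integrable_funrpos.
have im : leb.-integrable setT (fun t => (phi^\-%R t * ppow (p - 1) t)%:E).
  under eq_fun do rewrite mE.
  exact: integrable_funrneg.
have mp : measurable_fun setT phi^\+%R by exact: measurable_funrpos.
have mm : measurable_fun setT phi^\-%R by exact: measurable_funrneg.
have phiE t : phi t = phi^\+%R t - phi^\-%R t by rewrite -[in LHS](funrposBneg phi).
have -> : \int[leb]_t (phi t * ppow (p - 1) t) =
    \int[leb]_t (phi^\+%R t * ppow (p - 1) t) - \int[leb]_t (phi^\-%R t * ppow (p - 1) t).
  rewrite -RintegralB//; apply: eq_Rintegral => t _.
  by rewrite -mulrBl -phiE.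
have -> : \int[L]_x (phi (N x) * h x) =
    \int[L]_x (phi^\+%R (N x) * h x) - \int[L]_x (phi^\-%R (N x) * h x).
  rewrite -RintegralB//.
  - by apply: eq_Rintegral => x _; rewrite -mulrBl -phiE.
  - exact: radial_integrable.
  - exact: radial_integrable.
rewrite (step _ _ mh hh ih mp (funrpos_ge0 _) ip).
rewrite (step _ _ mh hh ih mm (funrneg_ge0 _) im).
by ring.
Qed.

End signed.
End radial.

Lemma is_radial_Rn {R : realType} d : (0 < d)%N ->
  is_radial (lebesgue_n R d) d (@sqnorm R d) (@scaleRn R d).
Proof.
move=> d0; split.
- exact: measurable_sqnorm.
- exact: sqnorm_ge0.
- exact: sqnorm_null.
- by move=> c; exact: measurable_scaleRn.
- exact: sqnormZ.
- by move=> c f; exact: ge0_integral_scaleRn.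
Qed.

(** A second instance of polar integration, used for the moments of exp(-t^2). *)
Lemma is_radial_line {R : realType} :
  is_radial (@lebesgue_measure R) 1 (fun t : R => t ^+ 2) (fun c t : R => c * t).
Proof.
split.
- by apply: measurable_funX.
- by move=> t; exact: sqr_ge0.
- rewrite (_ : [set _ | _] = [set 0]); first exact: lebesgue_measure_set1.
  apply/seteqP; split => t /=; first by move/eqP; rewrite sqrf_eq0 => /eqP.
  by move=> ->; rewrite expr0n.
- by move=> c; exact: measurable_funM.
- by move=> c t; rewrite exprMn.
- move=> c f c0 mf f0; rewrite expr1 -(ge0_integral_affine 0 c0 mf f0).
  by apply: eq_integral => t _; rewrite addr0.
Qed.

(** * Gaussian integrals of polynomials *)

Section moments.
Context {R : realType}.
Local Notation leb := (@lebesgue_measure R).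

Lemma integrable_gamma (p : R) : 0 < p ->
  leb.-integrable setT (fun t => (expR (- t) * ppow (p - 1) t)%:E).
Proof.
move=> p0; apply/integrableP; split.
  apply/measurable_EFinP/measurable_funM; last exact: measurable_ppow.
  by apply: measurableT_comp.
have := eGamma_fin p0; rewrite ge0_fin_numE ?eGamma_ge0//; congr (_ < _)%E.
apply: eq_integral => t _; rewrite /= ger0_norm 1?mulrC//.
by rewrite mulr_ge0 ?ppow_ge0 ?expR_ge0.
Qed.

Lemma Rintegral_gamma (p : R) :
  \int[leb]_t (expR (- t) * ppow (p - 1) t) = Gamma p.
Proof.
rewrite GammaE /Rintegral /eGamma; congr fine.
by apply: eq_integral => t _; rewrite mulrC.
Qed.

Lemma Rintegral_opp (f : R -> R) : measurable_fun setT f ->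
  \int[leb]_t f (- t) = \int[leb]_t f t.
Proof.
move=> mf; have mf' : measurable_fun setT (EFin \o f) by exact/measurable_EFinP.
rewrite /Rintegral; congr fine; rewrite integralE [in RHS]integralE.
have E1 := ge0_integral_opp (measurable_funepos mf') (funepos_ge0 _).
have E2 := ge0_integral_opp (measurable_funeneg mf') (funeneg_ge0 _).
rewrite -E1 -E2; congr (_ - _)%E; apply: eq_integral => t _;
  by rewrite ?funeposE ?funenegE.
Qed.

Definition gauss_moment (a : nat) : R := \int[leb]_t (t ^+ a * expR (- t ^+ 2)).

Let sq (t : R) := t ^+ 2.

Let ball_line a : leb.-integrable setT (EFin \o ball_part sq (fun t => t ^+ a)).
Proof.
apply: (le_integrable measurableT _ _ (@integrable_indic_itv R (- 1) 1 true false)).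
  apply/measurable_EFinP/measurable_funM; last exact: measurable_funX.
  by apply: measurableT_comp; [exact: measurable_cut1|exact: measurable_funX].
move=> t _; rewrite /= lee_fin /ball_part /cut1 indicE mem_setE in_itv/= /sq.
have [t1|_] := boolP (t ^+ 2 <= 1); last by rewrite mul0r normr0.
have t11 : -1 <= t <= 1 by apply/andP; split; nra.
by rewrite t11 mul1r normr1 normrX exprn_ile1// ler_norml.
Qed.

Let homog_line a : homogeneous (fun c t : R => c * t) a (fun t : R => t ^+ a).
Proof. by move=> c t _; rewrite exprMn. Qed.

Let mpow a : measurable_fun setT (fun t : R => t ^+ a).
Proof. exact: measurable_funX. Qed.

Let mexpRN : measurable_fun setT (fun t : R => expR (- t)).
Proof. exact: measurableT_comp. Qed.

Let half_gt0 a : 0 < (a + 1)%:R / 2 :> R.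
Proof. by rewrite divr_gt0// addn1 ltr0n. Qed.

Lemma gauss_moment_integrable a :
  leb.-integrable setT (fun t => (t ^+ a * expR (- t ^+ 2))%:E).
Proof.
have := radial_integrable is_radial_line (ltn0Sn 0) (mpow a) (@homog_line a)
  (ball_line a) mexpRN (integrable_gamma (half_gt0 a)).
by apply: eq_integrable => // t _; rewrite mulrC.
Qed.

(* Polar integration on the line of [t ^+ a] against exp(-s) and s exp(-s),
   s = t^2, involves the same constant; their ratio is given by [GammaS]. *)
Lemma gauss_momentSS a :
  gauss_moment a.+2 = (a + 1)%:R / 2 * gauss_moment a.
Proof.
pose q : R := (a + 1)%:R / 2.
have q0 : 0 < q := half_gt0 a.
have E0 : gauss_moment a = q * (\int[leb]_t ball_part sq (fun t => t ^+ a) t) * Gamma q.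
  rewrite -Rintegral_gamma -(radial_Rintegral is_radial_line (ltn0Sn 0) (mpow a)
    (@homog_line a) (ball_line a) mexpRN (integrable_gamma q0)).
  by apply: eq_Rintegral => t _; rewrite mulrC.
have E1 (t : R) : t * expR (- t) * ppow (q - 1) t = expR (- t) * ppow (q + 1 - 1) t.
  rewrite -mulrA mulrCA; congr (_ * _); rewrite addrK /ppow; case: ifP => [t0|_].
    by rewrite mulr_powRB1// ltW.
  by rewrite mulr0.
have i1 : leb.-integrable setT (fun t : R => (t * expR (- t) * ppow (q - 1) t)%:E).
  under eq_fun do rewrite E1.
  by apply: integrable_gamma; rewrite addr_gt0.
have m1 : measurable_fun setT (fun t : R => t * expR (- t)) by exact: measurable_funM.
have := radial_Rintegral is_radial_line (ltn0Sn 0) (mpow a)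
    (@homog_line a) (ball_line a) m1 i1.
rewrite -/q (_ : \int[leb]_t (t * expR (- t) * ppow (q - 1) t) = Gamma (q + 1)); last first.
  by rewrite -Rintegral_gamma; apply: eq_Rintegral => t _; rewrite E1.
rewrite GammaS// E0 => E2.
transitivity (\int[leb]_x (x ^+ 2 * expR (- x ^+ 2) * x ^+ a)).
  by apply: eq_Rintegral => t _; rewrite exprSr exprSr expr2; ring.
by rewrite E2; ring.
Qed.

(** The recursion does not reach this value, which settles integration by parts for monomials that
    are constant in the variable of differentiation. *)
Lemma gauss_moment1 : gauss_moment 1 = 0.
Proof.
have m1 : measurable_fun setT (fun t : R => t ^+ 1 * expR (- t ^+ 2)).
  apply/measurable_EFinP; exact: measurable_int (gauss_moment_integrable 1).
suff : gauss_moment 1 = - 1 * gauss_moment 1 by lra.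
rewrite -[LHS](Rintegral_opp m1) -RintegralZl//; last exact: gauss_moment_integrable.
by apply: eq_Rintegral => t _; rewrite sqrrN !expr1 mulN1r mulNr.
Qed.

Lemma gauss_moment_gt0 : 0 < gauss_moment 0.
Proof.
rewrite -lte_fin fineK; last first.
  exact: (integrable_fin_num measurableT (gauss_moment_integrable 0)).
apply: (@ge0_integral_gt0 _ _ 0 1) => //.
- exact: measurable_int (gauss_moment_integrable 0).
- by move=> t; rewrite lee_fin expr0 mul1r expR_ge0.
- by move=> t _; rewrite lte_fin expr0 mul1r expR_gt0.
Qed.

End moments.

(** * Gaussian integration by parts on R^d *)

Section gauss.
Context {R : realType} {d : nat}.
Local Notation L := (lebesgue_n R d).
Implicit Types (p q : mpoly d R) (x : Rn R d).

Definition gauss p : R := \int[L]_x (mpeval p x * expR (- sqnorm x)).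

Let monom_gauss m x : mpeval (mpolyX R m) x * expR (- sqnorm x) =
  \prod_i (tnth x i ^+ m i * expR (- tnth x i ^+ 2)).
Proof.
rewrite /mpeval mevalX /sqnorm -sumrN expR_sum -big_split/=.
by apply: eq_bigr.
Qed.

Let gauss_integrable_monom m :
  L.-integrable setT (fun x => (mpeval (mpolyX R m) x * expR (- sqnorm x))%:E).
Proof.
under eq_fun do rewrite monom_gauss.
exact: (integral_prodRn (fun i => gauss_moment_integrable (m i))).1.
Qed.

Lemma gauss_monom m : gauss (mpolyX R m) = \prod_i gauss_moment (m i).
Proof.
rewrite /gauss /Rintegral; under eq_integral do rewrite monom_gauss.
by rewrite (integral_prodRn (fun i => gauss_moment_integrable (m i))).2.
Qed.

Lemma gauss_integrable p :
  L.-integrable setT (fun x => (mpeval p x * expR (- sqnorm x))%:E).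
Proof.
have -> : (fun x => (mpeval p x * expR (- sqnorm x))%:E) =
   fun x => (\sum_(m <- msupp p) (mcoeff m p)%:E *
     (mpeval (mpolyX R m) x * expR (- sqnorm x))%:E)%E.
  apply/funext => x; rewrite {1}(mpolyE p) /mpeval raddf_sum/= mulr_suml -sumEFin.
  by apply: eq_bigr => m _; rewrite mevalZ -mulrA EFinM.
apply: integrable_sum => // m _.
by apply: integrableZl => //; exact: gauss_integrable_monom.
Qed.

Lemma gaussD p q : gauss (p + q) = gauss p + gauss q.
Proof.
rewrite /gauss -RintegralD//; try exact: gauss_integrable.
by apply: eq_Rintegral => x _; rewrite /mpeval rmorphD/= mulrDl.
Qed.

Lemma gaussZ a p : gauss (a *: p) = a * gauss p.
Proof.
rewrite /gauss -RintegralZl//; last exact: gauss_integrable.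
by apply: eq_Rintegral => x _; rewrite /mpeval mevalZ mulrA.
Qed.

Lemma gauss0 : gauss 0 = 0.
Proof. by rewrite -[0 in LHS](scale0r 0) gaussZ mul0r. Qed.

Lemma gauss_sum (I : Type) (r : seq I) (P : pred I) (F : I -> mpoly d R) :
  gauss (\sum_(i <- r | P i) F i) = \sum_(i <- r | P i) gauss (F i).
Proof.
exact: (big_morph _ gaussD gauss0).
Qed.

(** Integration by parts, as the i-th derivative of exp(-|x|^2) is -2 x_i exp(-|x|^2). On a monomial
    the integral factors over the coordinates, and only the i-th moment changes. *)
Lemma gauss_deriv i p : gauss (mderiv i p) = 2 * gauss (mpolyX R (mnm1 i) * p).
Proof.
rewrite {1 2}(mpolyE p) mulr_sumr raddf_sum/= !gauss_sum mulr_sumr.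
apply: eq_bigr => m _; rewrite mderivZ -scalerAr !gaussZ mulrCA; congr (_ * _).
rewrite mderivX gaussZ -mpolyXD !gauss_monom (bigD1 i)//= [in RHS](bigD1 i)//=.
rewrite mnmBE mnmDE mnm1E eqxx mulrA mulrA.
have -> : \prod_(j < d | j != i) gauss_moment (mnm_sub m (mnm1 i) j) =
          \prod_(j < d | j != i) gauss_moment (mnm_add (mnm1 i) m j) :> R.
  apply: eq_bigr => j ji; rewrite mnmBE mnmDE mnm1E.
  by rewrite eq_sym (negbTE ji) subn0.
congr (_ * _); case: (m i) => [|a]; first by rewrite mul0r addn0 gauss_moment1 mulr0.
rewrite subn1 add1n/= gauss_momentSS addn1 mulrA; congr (_ * _).
by rewrite mulrCA mulfV ?mulr1.
Qed.

Lemma gauss1_gt0 : 0 < gauss 1.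
Proof.
rewrite -mpolyX0 gauss_monom; apply: prodr_gt0 => i _.
by rewrite mnm0E; exact: gauss_moment_gt0.
Qed.

End gauss.

(** * Integrals over the ball and the sphere *)

Section jacobi.
Context {R : realType}.
Local Notation leb := (@lebesgue_measure R).
Implicit Types (a b mu : R) (q : {poly R}).

(** The Jacobi integral moved to [0, 1]: the form in which polar integration delivers q(2|x|^2 - 1)
    (1 - |x|^2)^mu. *)
Definition beta_int mu b q : R :=
  \int[leb]_t (q.[2 * t - 1] * ppow mu (1 - t) * ppow b t).

Lemma horner_bound q : exists C : R, forall t, -1 <= t <= 1 -> `|q.[t]| <= C.
Proof.
exists (\sum_(i < size q) `|q`_i|) => t t1; rewrite horner_coef.
apply: (le_trans (ler_norm_sum _ _ _)); apply: ler_sum => i _.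
rewrite normrM normrX ler_piMr// exprn_ile1// ler_norml//.
Qed.

Lemma measurable_horner disp (T : measurableType disp) q (f : T -> R) :
  measurable_fun setT f -> measurable_fun setT (fun x => q.[f x]).
Proof.
move=> mf; under eq_fun do rewrite horner_coef.
by apply: measurable_sum => i; apply: measurable_funM => //; exact: measurable_funX.
Qed.

Let measurable_affine : measurable_fun setT (fun t : R => 2 * t - 1).
Proof. by apply: measurable_funB => //; exact: measurable_funM. Qed.

Lemma measurable_radial_weight mu q :
  measurable_fun setT (fun t : R => q.[2 * t - 1] * ppow mu (1 - t)).
Proof.
apply: measurable_funM; first exact: measurable_horner.
by apply: measurableT_comp; [exact: measurable_ppow|exact: measurable_funB].
Qed.

(** The polynomial is bounded on [-1, 1], so a Beta integral dominates. *)
Lemma beta_integrable mu b q : -1 < mu -> -1 < b ->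
  leb.-integrable setT (fun t : R => (q.[2 * t - 1] * ppow mu (1 - t) * ppow b t)%:E).
Proof.
move=> mu1 b1; have [C qC] := horner_bound q.
have C0 : 0 <= C by apply: le_trans (qC 0 _); rewrite ?normr_ge0// oppr_le0 ler01.
have b0' : 0 < b + 1 by lra.
have mu0' : 0 < mu + 1 by lra.
have mB : measurable_fun setT (fun t : R => ppow b t * ppow mu (1 - t)).
  apply: measurable_funM; first exact: measurable_ppow.
  by apply: measurableT_comp; [exact: measurable_ppow|exact: measurable_funB].
have iB : leb.-integrable setT (fun t : R => (ppow b t * ppow mu (1 - t))%:E).
  apply/integrableP; split; first exact/measurable_EFinP.
  have := eBetaE b0' mu0'; rewrite /eBeta !addrK => E.
  rewrite (_ : (\int[leb]_t `| _ | = \int[leb]_t (ppow b t * ppow mu (1 - t))%:E)%E).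
    by rewrite E ltry.
  apply: eq_integral => t _; rewrite /= ger0_norm// mulr_ge0 ?ppow_ge0//.
apply: (le_integrable measurableT _ _ (integrableZl measurableT C iB)).
  apply/measurable_EFinP; apply: measurable_funM; last exact: measurable_ppow.
  exact: measurable_radial_weight.
move=> t _; rewrite -EFinM /= lee_fin -mulrA [X in _ * X]mulrC !normrM (ger0_norm C0).
have [t0|t0] := ltP 0 t; last by rewrite (ppow_le0E _ t0) normr0 mul0r !mulr0.
have [t1|t1] := ltP 0 (1 - t); last by rewrite (ppow_le0E _ t1) normr0 !mulr0.
by apply: ler_wpM2r; [rewrite mulr_ge0|apply: qC; lra].
Qed.

(** Substituting t = 2s - 1, the weight contributes 2^mu and 2^b, and dt = 2 ds the remaining
    factor. *)
Lemma Rintegral_jacobi_weight mu b q : -1 < mu -> -1 < b ->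
  \int[leb]_(t in `]-1, 1[) (q.[t] * jacobi_weight mu b t) =
  2 `^ (mu + b + 1) * beta_int mu b q.
Proof.
move=> mu1 b1; have p2 r : (2^-1 : R) `^ r * 2 `^ r = 1.
  by rewrite -powRM ?invr_ge0// mulVf ?powR1.
pose F (s : R) := q.[2 * s - 1] * ppow mu (1 - s) * ppow b s.
have E t : ((fun t => q.[t] * jacobi_weight mu b t) \_ `]-1, 1[) t =
    2 `^ mu * 2 `^ b * F (2^-1 * t + 2^-1).
  rewrite patchE mem_setE in_itv/= /F.
  have -> : 2 * (2^-1 * t + 2^-1) - 1 = t by field.
  have -> : 1 - (2^-1 * t + 2^-1) = 2^-1 * (1 - t) by field.
  have -> : 2^-1 * t + 2^-1 = 2^-1 * (1 + t) by field.
  rewrite !ppowZ ?invr_gt0// /ppow subr_gt0 -ltrBlDl sub0r /jacobi_weight.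
  case: ltP => /= t1; last by rewrite !mulr0.
  case: ltP => _; last by rewrite !(mulr0, mul0r).
  transitivity (((2^-1 : R) `^ mu * 2 `^ mu) * ((2^-1 : R) `^ b * 2 `^ b) *
      (q.[t] * ((1 - t) `^ mu * (1 + t) `^ b))); last by ring.
  by rewrite !p2 !mul1r.
have mF : measurable_fun setT F.
  apply: measurable_funM; [exact: measurable_radial_weight|exact: measurable_ppow].
rewrite Rintegral_mkcond; under eq_Rintegral do rewrite E.
have mF' : measurable_fun setT (fun t => 2 `^ mu * 2 `^ b * F t).
  exact: measurable_funM.
have h0 : 0 < 2^-1 :> R by rewrite invr_gt0.
rewrite (Rintegral_affine 2^-1 h0 mF') invrK RintegralZl//; last exact: beta_integrable.
rewrite !powRD ?pnatr_eq0 ?implybT// powRr1// -/(beta_int mu b q).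
by rewrite mulrA (mulrC 2).
Qed.

End jacobi.

(** * Homogeneous polynomials on the ball and the surface measure *)

Section ball.
Context {R : realType} {d : nat}.
Hypothesis d0 : (0 < d)%N.
Local Notation leb := (@lebesgue_measure R).
Local Notation L := (lebesgue_n R d).
Local Notation homog k p := (p \is ishomog1 k mdeg).
Implicit Types (p h : mpoly d R) (x : Rn R d) (q : {poly R}) (mu : R) (k : nat).

Lemma homogeneous_mpeval k p : homog k p ->
  homogeneous (@scaleRn R d) k (mpeval p).
Proof.
move=> /dhomogP hp c x c0; rewrite /mpeval !mevalE mulr_sumr.
rewrite !big_seq; apply: eq_bigr => m mp; rewrite mulrCA; congr (_ * _).
rewrite -(hp _ mp) /= mdegE expr_sum -big_split/=.
by apply: eq_bigr => i _; rewrite tnth_mktuple exprMn.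
Qed.

(* On the unit ball 1 <= exp(1 - |x|^2), so the Gaussian dominates. *)
Lemma ball_part_integrable p :
  L.-integrable setT (EFin \o ball_part (@sqnorm R d) (mpeval p)).
Proof.
apply: (le_integrable measurableT _ _ (integrableZl measurableT (expR 1) (gauss_integrable p))).
  apply/measurable_EFinP; apply: (measurable_ball_part (is_radial_Rn d0)).
  exact: measurable_mpeval.
move=> x _; rewrite /= lee_fin /ball_part /cut1.
case: ifPn => [N1|_]; last by rewrite mul0r normr0.
rewrite mul1r mulrCA normrM ler_peMr// -expRD ger0_norm ?expR_ge0//.
by rewrite -[X in X <= _]expR0 ler_expR subr_ge0.
Qed.

Definition ball_int p : R := \int[L]_x ball_part (@sqnorm R d) (mpeval p) x.

(** For p homogeneous of degree k this is the sphere integral, since r^(k+d-1) integrates to 1/(k+d)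
    over [0, 1]; [sphere_Rintegral] identifies it with the surface integral. *)
Definition sphere_int k p : R := (k + d)%:R * ball_int p.

Let half_gt0 k : 0 < (k + d)%:R / 2 :> R.
Proof. by rewrite divr_gt0// ltr0n addn_gt0 d0 orbT. Qed.

Lemma gauss_sphere k p : homog k p ->
  gauss p = sphere_int k p / 2 * Gamma ((k + d)%:R / 2).
Proof.
move=> hp; rewrite /gauss -Rintegral_gamma.
have mexp : measurable_fun setT (fun t : R => expR (- t)) by exact: measurableT_comp.
have := radial_Rintegral (is_radial_Rn d0) d0 (measurable_mpeval p)
  (homogeneous_mpeval hp) (ball_part_integrable p) mexp (integrable_gamma (half_gt0 k)).
rewrite (_ : sphere_int k p / 2 = (k + d)%:R / 2 * ball_int p); last first.
  by rewrite /sphere_int mulrAC.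
by move=> <-; apply: eq_Rintegral => x _; rewrite mulrC.
Qed.

Lemma enorm_le1 x : (enorm x <= 1) = (sqnorm x <= 1).
Proof.
by rewrite -enorm_sqr expr_le1// sqrtr_ge0.
Qed.

Section weighted.
Variables (mu : R) (mu1 : -1 < mu) (k : nat) (p : mpoly d R) (hp : homog k p).
Variable q : {poly R}.

Let f x := q.[2 * enorm x ^+ 2 - 1] * mpeval p x * ball_weight mu x.
Let phi (t : R) := q.[2 * t - 1] * ppow mu (1 - t).
Let b : R := (k + d)%:R / 2 - 1.

Let b1 : -1 < b.
Proof. by rewrite /b ltrBrDr addNr. Qed.

(** The sphere is excluded because of mu = 0: there [powR] gives 0^0 = 1 but [ppow] gives 0. *)
Let f_ae x : sqnorm x != 1 -> (f \_ (unit_ball R d)) x = phi (sqnorm x) * mpeval p x.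
Proof.
move=> N1; rewrite patchE.
have -> : (x \in unit_ball R d) = (sqnorm x <= 1).
  by rewrite -enorm_le1; apply/idP/idP => [/set_mem|/mem_set].
rewrite /f /phi /ball_weight enorm_sqr.
rewrite /ppow subr_gt0 lt_neqAle N1/=.
by case: ifP => _; rewrite ?mulr0 ?mul0r// mulrAC.
Qed.

Let sphere_null : L [set x | sqnorm x = 1] = 0%E.
Proof.
have E x : mpeval (normsq_poly - 1) x = sqnorm x - 1.
  by rewrite -enorm_sqr -mpeval_normsq /mpeval rmorphB rmorph1.
have -> : [set x : Rn R d | sqnorm x = 1] = [set x | mpeval (normsq_poly - 1) x = 0].
  by apply/seteqP; split => x /=; rewrite E => /eqP; rewrite ?subr_eq0 => /eqP //;
    move=> ->; rewrite subrr.
apply: mpeval_null; apply/eqP => /(congr1 (meval (fun=> 0))).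
rewrite raddf0 rmorphB rmorph1 /normsq_poly raddf_sum/= big1 => [|i _]; last first.
  by rewrite rmorphXn/= mevalXU expr0n.
by rewrite sub0r => /eqP; rewrite oppr_eq0 oner_eq0.
Qed.

Lemma measurable_unit_ball : measurable (unit_ball R d).
Proof.
rewrite (_ : unit_ball R d = setT `&` enorm @^-1` `]-oo, 1]%classic).
  by apply: measurable_enorm => //; exact: measurable_itv.
by apply/seteqP; split => x /=; rewrite in_itv/= ?setTI// => -[].
Qed.

Let measurable_f : measurable_fun setT f.
Proof.
have -> : f = fun x => q.[2 * sqnorm x - 1] * mpeval p x * (1 - sqnorm x) `^ mu.
  by apply/funext => x; rewrite /f /ball_weight enorm_sqr.
apply: measurable_funM.
  apply: measurable_funM; last exact: measurable_mpeval.
  apply: measurable_horner; apply: measurable_funB => //.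
  by apply: measurable_funM => //; exact: measurable_sqnorm.
apply: (measurableT_comp (measurable_powR mu)).
by apply: measurable_funB => //; exact: measurable_sqnorm.
Qed.

Let measurable_g : measurable_fun setT (fun x => phi (sqnorm x) * mpeval p x).
Proof.
apply: measurable_funM; last exact: measurable_mpeval.
by apply: measurableT_comp; [exact: measurable_radial_weight|exact: measurable_sqnorm].
Qed.

Let f_ae_eq : ae_eq L setT (EFin \o (f \_ (unit_ball R d)))
  (fun x => (phi (sqnorm x) * mpeval p x)%:E).
Proof.
exists [set x | sqnorm x = 1]; split.
- rewrite -[X in measurable X]setTI.
  exact: (measurable_sqnorm measurableT (measurable_set1 1)).
- exact: sphere_null.
- move=> x /= /not_implyP[_ nef]; apply: contrapT => /eqP N1.
  by apply: nef; rewrite f_ae.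
Qed.

Let measurable_fr : measurable_fun setT (EFin \o (f \_ (unit_ball R d))).
Proof.
apply/measurable_EFinP; apply/(measurable_restrictT f measurable_unit_ball).
exact: measurable_funTS.
Qed.

Let g_integrable : L.-integrable setT (fun x => (phi (sqnorm x) * mpeval p x)%:E).
Proof.
apply: (radial_integrable (is_radial_Rn d0) d0 (measurable_mpeval p)
  (homogeneous_mpeval hp) (ball_part_integrable p)).
  exact: measurable_radial_weight.
exact: beta_integrable.
Qed.

Lemma ball_weight_integrable : L.-integrable (unit_ball R d) (EFin \o f).
Proof.
apply/integrable_mkcond; first exact: measurable_unit_ball.
rewrite restrict_EFin.
have /integrableP[mg ig] := g_integrable.
apply/integrableP; split; first exact: measurable_fr.
move: ig; congr (_ < _)%E; apply: ae_eq_integral => //.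
- by apply: measurableT_comp => //.
- by apply: measurableT_comp => //.
- by apply: ae_eq_comp; exact: ae_eq_sym.
Qed.

Lemma ball_weight_Rintegral : \int[L]_(x in unit_ball R d) f x =
  sphere_int k p / 2 * beta_int mu b q.
Proof.
rewrite (_ : sphere_int k p / 2 = (k + d)%:R / 2 * ball_int p); last first.
  by rewrite /sphere_int mulrAC.
rewrite -(radial_Rintegral (is_radial_Rn d0) d0 (measurable_mpeval p)
  (homogeneous_mpeval hp) (ball_part_integrable p)
  (measurable_radial_weight _ _) (beta_integrable _ mu1 b1)).
rewrite Rintegral_mkcond /Rintegral; congr fine.
apply: ae_eq_integral => //; exact/measurable_EFinP.
Qed.

End weighted.

Lemma ge0_integral_surface_measure (f : Rn R d -> \bar R) :
  measurable_fun setT f -> (forall x, 0 <= f x)%E ->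
  (\int[surface_measure R d]_(x in unit_sphere R d) f x =
   d%:R%:E * \int[L]_(x in @punctured_ball R d) f (direction x))%E.
Proof.
move=> mf f0.
have mP := @measurable_punctured_ball R d.
have mD := @measurable_direction R d.
have mS : measurable (unit_sphere R d).
  rewrite (_ : unit_sphere R d = setT `&` enorm @^-1` [set 1]).
    by apply: measurable_enorm => //.
  by apply/seteqP; split => x /=; rewrite ?setTI// => -[].
pose cone : {measure set (Rn R d) -> \bar R} := mrestr L mP.
pose dk := @NngNum R d%:R (ler0n _ _).
pose m : {measure set (Rn R d) -> \bar R} := mscale dk
  (measure_function_pushforward__canonical__measure_function_Measure cone mD).
rewrite (@eq_measure_integral _ _ _ _ m)//.
rewrite ge0_integral_mscale//=; last exact: measurable_funTS.
congr (_ * _)%E.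
rewrite (ge0_integral_pushforward mD cone mS (measurable_funTS mf)); last by move=> x _.
have mfD : measurable_fun setT (f \o @direction R d) by exact: measurableT_comp.
have mDS : measurable (@direction R d @^-1` unit_sphere R d).
  by rewrite -[X in measurable X]setTI; exact: (@measurable_direction R d measurableT).
have sub : @punctured_ball R d `<=` @direction R d @^-1` unit_sphere R d.
  move=> x /= /andP[x0 _]; rewrite /unit_sphere/= /enorm.
  under eq_bigr do rewrite tnth_mktuple expr_div_n.
  rewrite -mulr_suml -/(sqnorm x) -enorm_sqr mulfV ?sqrtr1// expf_neq0// gt_eqF//.
(* The cone measure does not charge the complement of the punctured ball, and by [sub] every point
   of the punctured ball has its direction on the sphere. *)
rewrite (@ge0_negligible_integral _ _ _ cone _ (~` @punctured_ball R d))//.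
- rewrite (_ : _ `\` _ = @punctured_ball R d); last first.
    apply/seteqP; split => [x [_ /contrapT//]|x Px]; split; first exact: sub.
    by move=> /(_ Px).
  apply: eq_measure_integral => A mA AP.
  by rewrite /cone /= /mrestr setIidl.
- exact: measurableC.
- exact: measurable_funTS.
- by move=> x _; exact: f0.
- by rewrite /cone /= /mrestr setICl measure0.
Qed.

Lemma integral_surface_measure (f : Rn R d -> \bar R) : measurable_fun setT f ->
  (\int[surface_measure R d]_(x in unit_sphere R d) f x =
   d%:R%:E * \int[L]_(x in @punctured_ball R d) f (direction x))%E.
Proof.
move=> mf; rewrite integralE [in RHS]integralE gt0_muleBr ?ltr0n//;
  [|by apply: integral_ge0..].
rewrite !ge0_integral_surface_measure//;
  [|exact: measurable_funeneg|exact: measurable_funepos].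
by congr (_ * _ - _ * _)%E; apply: eq_integral => x _; rewrite ?funeposE ?funenegE.
Qed.

(** Since p(x/|x|) = |x|^(-k) p(x), the integral over cones is a polar integral with profile
    t^(-k/2) on ]0, 1]. The profile cancels the degree of p and leaves the integral of t^(d/2-1),
    that is 2/d. *)
Lemma sphere_Rintegral k p : homog k p ->
  \int[surface_measure R d]_(x in unit_sphere R d) mpeval p x = sphere_int k p.
Proof.
move=> hp; pose r : R := - (k%:R / 2).
pose phi (t : R) := cut1 t * ppow r t.
have mphi : measurable_fun setT phi.
  by apply: measurable_funM; [exact: measurable_cut1|exact: measurable_ppow].
have e : r + ((k + d)%:R / 2 - 1) = d%:R / 2 - 1 by rewrite /r natrD; field.
have d20 : 0 < d%:R / 2 :> R by rewrite divr_gt0// ltr0n.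
have Ephi : (\int[leb]_t (phi t * ppow ((k + d)%:R / 2 - 1) t)%:E = ((d%:R / 2)^-1)%:E)%E.
  rewrite -integral_powR01// [in RHS]integral_mkcond; apply: eq_integral => t _.
  rewrite /phi -mulrA -ppowD e patchE mem_setE in_itv/= /cut1 /ppow.
  by case: (0 < t); case: (t <= 1); rewrite /= ?(mul0r, mul1r, mulr0).
have iphi : leb.-integrable setT (fun t => (phi t * ppow ((k + d)%:R / 2 - 1) t)%:E).
  apply/integrableP; split.
    by apply/measurable_EFinP; apply: measurable_funM => //; exact: measurable_ppow.
  under eq_integral do rewrite gee0_abs ?lee_fin ?mulr_ge0 ?ppow_ge0 ?cut1_ge0//.
  by rewrite Ephi ltry.
have := radial_Rintegral (is_radial_Rn d0) d0 (measurable_mpeval p)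
  (homogeneous_mpeval hp) (ball_part_integrable p) mphi iphi.
rewrite [X in _ * X](_ : _ = (d%:R / 2)^-1); last by rewrite /Rintegral Ephi.
move=> Er.
have mpd : measurable_fun setT (EFin \o mpeval p).
  by apply/measurable_EFinP; exact: measurable_mpeval.
rewrite /Rintegral (integral_surface_measure mpd).
transitivity (d%:R * \int[L]_x (phi (sqnorm x) * mpeval p x)); last first.
  rewrite Er -/(ball_int p) /sphere_int; field.
  by rewrite pnatr_eq0 -lt0n.
have E : (\int[L]_(x in @punctured_ball R d) (EFin \o mpeval p) (direction x) =
    \int[L]_x (phi (sqnorm x) * mpeval p x)%:E)%E.
  rewrite integral_mkcond; apply: eq_integral => x _; rewrite patchE.
  have e0 : 0 <= enorm x := sqrtr_ge0 _.
  have -> : (x \in @punctured_ball R d) = (0 < sqnorm x) && (sqnorm x <= 1).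
    have -> : (0 < sqnorm x) = (0 < enorm x) by rewrite sqrtr_gt0.
    rewrite -enorm_le1.
    by apply/idP/idP => [/set_mem|/mem_set].
  rewrite /phi /cut1 /ppow; case: ltP => N0; last by rewrite !(mulr0, mul0r).
  case: (sqnorm x <= 1); last by rewrite !(mulr0, mul0r).
  rewrite mul1r /=; congr EFin.
  have en0 : 0 < enorm x by rewrite sqrtr_gt0.
  have -> : direction x = scaleRn (enorm x)^-1 x.
    by apply: eq_from_tnth => i; rewrite !tnth_mktuple mulrC.
  rewrite (homogeneous_mpeval hp) ?invr_gt0//; congr (_ * _).
  rewrite -enorm_sqr -powR_mulrn// -powRrM /r.
  rewrite (_ : 2 * - (k%:R / 2) = - k%:R); last by field.
  by rewrite powR_invn// exprVn.
rewrite E fineM//.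
exact: (integrable_fin_num measurableT (radial_integrable (is_radial_Rn d0) d0
  (measurable_mpeval p) (homogeneous_mpeval hp) (ball_part_integrable p) mphi iphi)).
Qed.

End ball.

(** * Harmonic polynomials *)

Section harmonic.
Context {R : realType} {d : nat}.
Local Notation homog k p := (p \is ishomog1 k mdeg).
Local Notation Xi i := (mpolyX R (mnm1 (i : 'I_d))).
Implicit Types (p q Y Z : mpoly d R) (f g : {poly R}).

Lemma mderiv_sum i (I : Type) (r : seq I) (P : pred I) (F : I -> mpoly d R) :
  mderiv i (\sum_(j <- r | P j) F j) = \sum_(j <- r | P j) mderiv i (F j).
Proof. exact: raddf_sum. Qed.

Lemma mderivXU i j : mderiv i (Xi j) = (i == j)%:R.
Proof.
rewrite mderivX mnm1E eq_sym; case: eqP => [->|_]; last by rewrite scale0r.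
have -> : mnm_sub (mnm1 j) (mnm1 j) = mnm0.
  by apply/mnmP => k; rewrite mnmBE subnn mnm0E.
by rewrite mpolyX0 scale1r.
Qed.

Lemma mderiv_normsq i : mderiv i (@normsq_poly R d) = Xi i *+ 2.
Proof.
rewrite /normsq_poly mderiv_sum (bigD1 i)// big1 => [|j ji].
  by rewrite Monoid.mulm1 expr2 mderivM mderivXU eqxx mul1r mulr1 -mulr2n.
by rewrite expr2 mderivM mderivXU eq_sym (negbTE ji) mul0r mulr0 addr0.
Qed.

Lemma homog_mderiv k i p : homog k.+1 p -> homog k (mderiv i p).
Proof.
move=> hp; apply/dhomogP => m; rewrite mcoeff_msupp mcoeff_deriv => pm.
have mp : mnm_add m (mnm1 i) \in msupp p.
  by rewrite mcoeff_msupp; apply: contra pm => /eqP ->; rewrite mul0rn.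
by move/dhomogP: hp => /(_ _ mp) /=; rewrite mdegD mdeg1 addn1 => -[].
Qed.

Lemma homog0_mderiv i p : homog 0 p -> mderiv i p = 0.
Proof.
move=> hp; apply/mpolyP => m; rewrite mcoeff_deriv mcoeff0.
rewrite (_ : mcoeff _ p = 0) ?mul0rn//; apply: (dhomog_nemf_coeff hp).
by rewrite /= mdegD mdeg1 addn1.
Qed.

Lemma euler_homog k p : homog k p -> \sum_i Xi i * mderiv i p = k%:R *: p.
Proof.
move=> hp; have EX m : \sum_i Xi i * mderiv i (mpolyX R m) = (mdeg m)%:R *: mpolyX R m.
  under eq_bigr => i _.
    rewrite mderivX -scalerAr -mpolyXD.
    (* Truncated subtraction does no harm: when m i = 0 the coefficient is 0. *)
    have -> : (m i)%:R *: mpolyX R (mnm_add (mnm1 i) (mnm_sub m (mnm1 i))) =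
        (m i)%:R *: mpolyX R m.
      case: (posnP (m i)) => [->|mi]; first by rewrite !scale0r.
      by rewrite addmC submK// lep1mP -lt0n.
    over.
  by rewrite /= -scaler_suml mdegE natr_sum.
rewrite {1}(mpolyE p) [in RHS](mpolyE p) scaler_sumr.
under eq_bigr do rewrite mderiv_sum mulr_sumr.
rewrite exchange_big/= !big_seq; apply: eq_bigr => m mp.
under eq_bigr do rewrite /= mderivZ -scalerAr.
by rewrite -scaler_sumr EX (dhomog_mf hp mp) !scalerA mulrC.
Qed.

Lemma grad_dotC p q : grad_dot p q = grad_dot q p.
Proof. by apply: eq_bigr => i _; rewrite mulrC. Qed.

(* Gaussian integration by parts followed by Euler's identity. *)
Lemma gauss_grad_dot m p Z : harmonic_poly R d m Z ->
  gauss (grad_dot p Z) = 2 * m%:R * gauss (p * Z).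
Proof.
move=> [hZ lZ].
have -> : grad_dot p Z = \sum_i mderiv i (p * mderiv i Z).
  under [RHS]eq_bigr do rewrite mderivM.
  by rewrite big_split/= -mulr_sumr -/(laplacian Z) lZ mulr0 addr0.
rewrite gauss_sum; under eq_bigr do rewrite gauss_deriv mulrCA.
rewrite -mulr_sumr -gauss_sum -mulr_sumr (euler_homog hZ).
by rewrite -scalerAr gaussZ mulrA.
Qed.

(** grad Y . grad Z is symmetric, so its Gaussian integral is both 2m and 2n times that of Y Z. *)
Lemma gauss_harmonic_ortho m n Y Z : harmonic_poly R d m Y ->
  harmonic_poly R d n Z -> m != n -> gauss (Y * Z) = 0.
Proof.
move=> hY hZ mn; have := gauss_grad_dot Z hY.
rewrite grad_dotC (gauss_grad_dot Y hZ) (mulrC Z) -!mulrA.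
move=> e; apply/eqP; move/eqP: e.
rewrite -subr_eq0 -mulrBr -mulrBl !mulf_eq0 pnatr_eq0/= subr_eq0 eqr_nat.
by rewrite eq_sym (negbTE mn).
Qed.

Section dim.
Hypothesis d0 : (0 < d)%N.

Let half_gt0 k : 0 < (k + d)%:R / 2 :> R.
Proof. by rewrite divr_gt0// ltr0n addn_gt0 d0 orbT. Qed.

Lemma sphere_int_gauss k p : homog k p ->
  sphere_int k p = 2 * gauss p / Gamma ((k + d)%:R / 2).
Proof.
move=> hp; rewrite (gauss_sphere d0 hp); field.
by rewrite gt_eqF// Gamma_gt0.
Qed.

Lemma homog_grad_dot k l p q : homog k.+1 p -> homog l.+1 q ->
  homog (k + l) (grad_dot p q).
Proof.
move=> hp hq; rewrite /grad_dot; apply: rpred_sum => i _.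
by apply: dhomogM; exact: homog_mderiv.
Qed.

Lemma sphere_int_grad_dot m Y Z : harmonic_poly R d m.+1 Y ->
  harmonic_poly R d m.+1 Z ->
  sphere_int (m + m) (grad_dot Y Z) =
  m.+1%:R * (2 * m.+1%:R + d%:R - 2) * sphere_int (m.+1 + m.+1) (Y * Z).
Proof.
move=> hY hZ; have [homY _] := hY; have [homZ _] := hZ.
rewrite (sphere_int_gauss (homog_grad_dot homY homZ)).
rewrite (sphere_int_gauss (dhomogM homY homZ)) (gauss_grad_dot Y hZ).
(* The gradients lower the total degree by 2, so the two Gamma arguments differ by 1. *)
have -> : (m.+1 + m.+1 + d)%:R / 2 = (m + m + d)%:R / 2 + 1 :> R.
  have -> : (m.+1 + m.+1 + d)%N = (m + m + d + 2)%N by rewrite addnS !addSn addn2.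
  by rewrite [in LHS]natrD; field.
rewrite GammaS//; set G := Gamma _.
have G0 : G != 0 by rewrite gt_eqF// Gamma_gt0.
have : (m + m + d)%:R != 0 :> R by rewrite pnatr_eq0 -lt0n addn_gt0 d0 orbT.
rewrite -[m.+1]addn1 !natrD => md0; field.
by rewrite G0 md0.
Qed.

Definition radial_arg : mpoly d R := 2%:R *: normsq_poly - 1.

Lemma mderiv_horner_alg i f :
  mderiv i (horner_alg radial_arg f) = 4 *: (horner_alg radial_arg f^`() * Xi i).
Proof.
have mn : mderiv i radial_arg = 4 *: Xi i.
  rewrite /radial_arg mderivB mderivZ -(mpolyC1 d R) mderivC subr0 mderiv_normsq.
  by rewrite !scaler_nat -mulrnA.
elim/poly_ind: f => [|f c IH]; first by rewrite deriv0 !raddf0 mul0r scaler0.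
rewrite derivD derivM derivX derivC mulr1 addr0.
rewrite !rmorphD !rmorphM/= horner_algX horner_algC mderivD mderivM IH mn.
rewrite alg_mpolyC mderivC addr0 -!scalerAr -scalerAl -scalerDr; congr (_ *: _).
ring.
Qed.

(** The radial gradients are 4 f' x and 4 g' x. Their product 16 |x|^2 f' g' becomes 8 (X + 1) f' g'
    because 2|x|^2 = t + 1 for t = 2|x|^2 - 1; Euler's identity evaluates the mixed terms. *)
Lemma grad_dot_radial m n Y Z f g : homog m Y -> homog n Z ->
  grad_dot (radial_mul f Y) (radial_mul g Z) =
  radial_mul (8 *: (('X + 1) * f^`() * g^`()) + (4 * n%:R) *: (f^`() * g) +
              (4 * m%:R) *: (f * g^`())) (Y * Z) +
  radial_mul (f * g) (grad_dot Y Z).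
Proof.
move=> hY hZ; rewrite /radial_mul -/radial_arg.
rewrite !rmorphD/= !linearZ/= !rmorphM/= rmorphD/= rmorph1 horner_algX.
set F := horner_alg radial_arg f; set F' := horner_alg radial_arg f^`().
set G := horner_alg radial_arg g; set G' := horner_alg radial_arg g^`().
have -> : radial_arg + 1 = 2 *: \sum_(i < d) Xi i ^+ 2 by rewrite /radial_arg subrK.
transitivity (16 *: ((\sum_i Xi i ^+ 2) * F' * G' * (Y * Z)) +
  4 *: (F' * G * Y * (\sum_i Xi i * mderiv i Z)) +
  4 *: (F * G' * Z * (\sum_i Xi i * mderiv i Y)) + F * G * grad_dot Y Z).
  rewrite /grad_dot !mulr_suml !mulr_sumr !scaler_sumr -!big_split/=.
  apply: eq_bigr => i _; rewrite !mderivM !mderiv_horner_alg -/F -/F' -/G -/G'.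
  rewrite !scaler_nat; ring.
rewrite (euler_homog hY) (euler_homog hZ) -!scalerA !scaler_nat.
rewrite -(mulr_natr Z) -(mulr_natr Y); ring.
Qed.

End dim.
End harmonic.

(** * The ball inner product of radial multiples of harmonic polynomials *)

Section ball_dot_formula.
Context {R : realType} {d : nat}.
Hypothesis d0 : (0 < d)%N.
Local Notation leb := (@lebesgue_measure R).
Local Notation L := (lebesgue_n R d).
Local Notation homog k p := (p \is ishomog1 k mdeg).
Implicit Types (p Y Z : mpoly d R) (f g q : {poly R}).
Variables (lam mu : R) (mu1 : -1 < mu).

Let mu0' : 0 < mu + 1.
Proof. by rewrite -ltrBlDr sub0r. Qed.

Lemma mpevalM p1 p2 (x : Rn R d) : mpeval (p1 * p2) x = mpeval p1 x * mpeval p2 x.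
Proof. by rewrite /mpeval rmorphM. Qed.

Lemma mpevalD p1 p2 (x : Rn R d) : mpeval (p1 + p2) x = mpeval p1 x + mpeval p2 x.
Proof. by rewrite /mpeval rmorphD. Qed.

Lemma homog1 : homog 0 (1 : mpoly d R).
Proof. exact: dhomog1. Qed.

(** [sphere_int 0 1] is the area of the sphere, by which [sphere_dot] divides. *)
Lemma sphere_int_gt0 : 0 < sphere_int 0 (1 : mpoly d R).
Proof.
rewrite (sphere_int_gauss d0 homog1).
rewrite divr_gt0 ?mulr_gt0 ?gauss1_gt0// Gamma_gt0//.
by rewrite divr_gt0// ltr0n.
Qed.

Lemma sphere_dotE m n Y Z : homog m Y -> homog n Z ->
  sphere_dot Y Z = sphere_int (m + n) (Y * Z) / sphere_int 0 (1 : mpoly d R).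
Proof.
move=> hY hZ; rewrite /sphere_dot mulrC; congr (_ / _).
  rewrite -(sphere_Rintegral d0 (dhomogM hY hZ)).
  by apply: eq_Rintegral => x _; rewrite mpevalM.
rewrite -(sphere_Rintegral d0 homog1).
by apply: eq_Rintegral => x _; rewrite /mpeval rmorph1.
Qed.

(** Half the area of the sphere times the Beta integral at (d/2, mu + 1): the weighted formula for p
    = q = 1. *)
Lemma ball_constE : @ball_const R d mu =
  (sphere_int 0 (1 : mpoly d R) / 2 *
   (Gamma (d%:R / 2) * Gamma (mu + 1) / Gamma (mu + 1 + d%:R / 2)))^-1.
Proof.
have d20 : 0 < d%:R / 2 :> R by rewrite divr_gt0// ltr0n.
rewrite /ball_const; congr (_^-1).
transitivity (\int[L]_(x in unit_ball R d)
    ((1 : {poly R}).[2 * enorm x ^+ 2 - 1] * mpeval 1 x * ball_weight mu x)).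
  by apply: eq_Rintegral => x _; rewrite hornerC /mpeval rmorph1 !mul1r.
rewrite (ball_weight_Rintegral d0 mu1 homog1) add0n; congr (_ * _).
rewrite (addrC (mu + 1)) /beta_int /Rintegral.
transitivity (fine (eBeta (d%:R / 2) (mu + 1))); last by rewrite eBetaE.
congr fine; apply: eq_integral => t _.
by rewrite hornerC mul1r addrK mulrC.
Qed.

Lemma ball_int_radial m n Y Z f g : homog m Y -> homog n Z ->
  \int[L]_(x in unit_ball R d) (mpeval (radial_mul f Y) x *
    mpeval (radial_mul g Z) x * ball_weight mu x) =
  sphere_int (m + n) (Y * Z) / 2 * beta_int mu ((m + n + d)%:R / 2 - 1) (f * g).
Proof.
move=> hY hZ.
rewrite -(ball_weight_Rintegral d0 mu1 (dhomogM hY hZ)).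
apply: eq_Rintegral => x _; rewrite !mpeval_radial_mul hornerM mpevalM; ring.
Qed.

(** The degree [l] is left free because for constant Y or Z the product of the gradients is 0, which
    is homogeneous of every degree. *)
Lemma ball_grad_radial m n l Y Z f g : homog m Y -> homog n Z ->
  homog l (grad_dot Y Z) ->
  \int[L]_(x in unit_ball R d) (mpeval (grad_dot (radial_mul f Y)
    (radial_mul g Z)) x * ball_weight mu x) =
  sphere_int (m + n) (Y * Z) / 2 *
    beta_int mu ((m + n + d)%:R / 2 - 1)
     (8 *: (('X + 1) * f^`() * g^`()) + (4 * n%:R) *: (f^`() * g) +
              (4 * m%:R) *: (f * g^`())) +
  sphere_int l (grad_dot Y Z) / 2 *
    beta_int mu ((l + d)%:R / 2 - 1) (f * g).
Proof.
move=> hY hZ hG; rewrite (grad_dot_radial _ _ hY hZ).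
rewrite -(ball_weight_Rintegral d0 mu1 (dhomogM hY hZ)).
rewrite -(ball_weight_Rintegral d0 mu1 hG).
rewrite -RintegralD//; last 3 first.
- exact: measurable_unit_ball.
- exact: ball_weight_integrable (dhomogM hY hZ) _.
- exact: ball_weight_integrable hG _.
apply: eq_Rintegral => x _.
by rewrite mpevalD !mpeval_radial_mul mpevalM mulrDl.
Qed.

Lemma beta_intD b f g : -1 < b ->
  beta_int mu b (f + g) = beta_int mu b f + beta_int mu b g.
Proof.
move=> b1; rewrite /beta_int -RintegralD//; try exact: beta_integrable.
by apply: eq_Rintegral => t _; rewrite hornerD !mulrDl.
Qed.

Lemma beta_intZ b c f : -1 < b -> beta_int mu b (c *: f) = c * beta_int mu b f.
Proof.
move=> b1; rewrite /beta_int -RintegralZl//; last exact: beta_integrable.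
by apply: eq_Rintegral => t _; rewrite hornerZ !mulrA.
Qed.

(** At 2t - 1 the factor X + 1 is 2t, which raises the exponent of t by one. *)
Lemma beta_intX1 b f : -1 < b ->
  beta_int mu b (('X + 1) * f) = 2 * beta_int mu (b + 1) f.
Proof.
move=> b1; rewrite /beta_int -RintegralZl//; last first.
  by apply: beta_integrable => //; apply: lt_trans b1 _; rewrite ltrDl.
apply: eq_Rintegral => t _; rewrite hornerM hornerD hornerX hornerC subrK.
have [t0|t0] := ltP 0 t; last by rewrite !(ppow_le0E _ t0) !mulr0.
rewrite !(ppow_gt0E _ t0).
by rewrite powRD ?(gt_eqF t0) ?implybT// powRr1 ?ltW//; ring.
Qed.

Let powRS1 (r : R) : 2 `^ (r + 1) = 2 * 2 `^ r.
Proof. by rewrite powRD ?pnatr_eq0 ?implybT// powRr1// mulrC. Qed.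

(** The derivative weight has exponent beta + 1, hence one more factor 2, which turns 8 lam into 16
    lam. *)
Lemma sob_dot0E f g : sob_dot d lam mu ((d%:R - 2) / 2) f g =
  2 `^ (d%:R / 2 + mu) * (beta_int mu (d%:R / 2 - 1) (f * g) +
    16 * lam * beta_int mu (d%:R / 2) (f^`() * g^`())).
Proof.
have d20 : 0 < d%:R / 2 :> R by rewrite divr_gt0// ltr0n.
rewrite /sob_dot eqxx (_ : (d%:R - 2) / 2 = d%:R / 2 - 1); last by field.
rewrite subrK.
under eq_Rintegral do rewrite -hornerM.
under [X in _ + _ * X]eq_Rintegral do rewrite -hornerM.
have b1 : -1 < d%:R / 2 - 1 :> R by rewrite ltrBrDr addNr.
have b2 : -1 < d%:R / 2 :> R by apply: lt_trans d20; rewrite oppr_lt0.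
rewrite (Rintegral_jacobi_weight _ mu1 b1) (Rintegral_jacobi_weight _ mu1 b2).
have -> : mu + d%:R / 2 + 1 = (d%:R / 2 + mu) + 1 by ring.
have -> : mu + (d%:R / 2 - 1) + 1 = d%:R / 2 + mu by ring.
rewrite powRS1.
move: (beta_int mu _ (f * g)) (beta_int mu _ (f^`() * g^`())) (2 `^ _) => B1 B2 P.
by ring.
Qed.

Lemma sob_dotSE m b f g : b = m.+1%:R + (d%:R - 2) / 2 ->
  sob_dot d lam mu b f g =
  2 `^ (b + mu + 1) * (beta_int mu b (f * g) + lam *
    (beta_int mu b (8 *: (('X + 1) * f^`() * g^`()) +
       (4 * m.+1%:R) *: (f^`() * g) + (4 * m.+1%:R) *: (f * g^`())) +
     m.+1%:R * (2 * m.+1%:R + d%:R - 2) * beta_int mu (b - 1) (f * g))).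
Proof.
move=> bE.
have d20 : 0 < d%:R / 2 :> R by rewrite divr_gt0// ltr0n.
have m0 : 1 <= m.+1%:R :> R by rewrite ler1n.
have b1 : -1 < b - 1 by rewrite bE; lra.
have b1' : -1 < b by lra.
have bn : (b == (d%:R - 2) / 2) = false.
  by apply/negbTE; rewrite bE -subr_eq0; apply/eqP; lra.
rewrite /sob_dot bn.
(* Apart from A f g, every term of the integrand is divisible by 1 + t; the quotient [r] is
   therefore integrated with exponent b instead of b - 1. It is half the polynomial produced by the
   gradient formula. *)
set r := 4 *: (('X + 1) * f^`() * g^`()) + (2 * m.+1%:R) *: (f^`() * g) +
    (2 * m.+1%:R) *: (f * g^`()).
set A : R := m.+1%:R * (2 * m.+1%:R + d%:R - 2).
have -> : 8 *: (('X + 1) * f^`() * g^`()) + (4 * m.+1%:R) *: (f^`() * g) +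
              (4 * m.+1%:R) *: (f * g^`()) = 2 *: r.
  by rewrite /r !scalerDr !scalerA mulrA -!natrM.
have q1 t : (sob_A d b * (f.[t] * g.[t])
          + sob_B d b * (1 + t) * (f.[t] * g^`().[t] + f^`().[t] * g.[t])
          + 4%:R * (1 + t) ^+ 2 * (f^`().[t] * g^`().[t])) =
    (A *: (f * g) + ('X + 1) * r).[t].
  rewrite /r /A !(hornerD, hornerM, hornerZ, hornerX, hornerC) /sob_A /sob_B bE.
  move: (f.[t]) (g.[t]) (f^`().[t]) (g^`().[t]) (m.+1%:R : R) (d%:R : R) => x1 x2 x3 x4 x5 x6.
  by field.
under [X in _ + _ * X]eq_Rintegral do rewrite q1.
under eq_Rintegral do rewrite -hornerM.
rewrite (Rintegral_jacobi_weight _ mu1 b1') (Rintegral_jacobi_weight _ mu1 b1).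
rewrite (beta_intD _ _ b1) (beta_intZ _ _ b1) (beta_intX1 _ b1) (beta_intZ _ _ b1').
rewrite -[mu + (b - 1) + 1]addrA subrK (addrC mu b) powRS1.
move: (beta_int mu b (f * g)) (beta_int mu b r) (beta_int mu (b - 1) (f * g)).
move: {q1}A (2 `^ (b + mu)) => A P B1 B2 B3; ring.
Qed.

(* This is [b_mu w_d / 2^(b + mu + 2)] in the notation of the paper. *)
Definition radial_norm_const (b : R) : R := Gamma (mu + 1 + d%:R / 2) /
  (Gamma (mu + 1) * Gamma (d%:R / 2) * 2 `^ (b + mu + 1)).

(** For positive degree the two parts of the gradient integral, with exponents b and b - 1, match
    the two terms of [sob_dotSE]. In degree 0 the second part disappears and [sob_dot] takes its
    exceptional branch. *)
Lemma ball_dot_radial m Y Z f g :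
  harmonic_poly R d m Y -> harmonic_poly R d m Z ->
  ball_dot lam mu (radial_mul f Y) (radial_mul g Z) =
  sphere_dot Y Z * (radial_norm_const (m%:R + (d%:R - 2) / 2) *
    sob_dot d lam mu (m%:R + (d%:R - 2) / 2) f g).
Proof.
move=> hY hZ; have [homY _] := hY; have [homZ _] := hZ.
have d20 : 0 < d%:R / 2 :> R by rewrite divr_gt0// ltr0n.
have := Gamma_gt0 mu0'; have := Gamma_gt0 d20; have := Gamma_gt0 (addr_gt0 mu0' d20).
have := sphere_int_gt0.
have := powR_gt0 (m%:R + (d%:R - 2) / 2 + mu + 1) (ltr0n R 2).
rewrite /ball_dot ball_constE (ball_int_radial _ _ homY homZ).
rewrite (sphere_dotE homY homZ) /radial_norm_const.
have eb : (m + m + d)%:R / 2 - 1 = m%:R + (d%:R - 2) / 2 :> R by rewrite !natrD; field.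
case: m hY hZ homY homZ eb => [|m] hY hZ homY homZ eb.
  have gYZ : grad_dot Y Z = 0.
    by rewrite /grad_dot big1// => i _; rewrite (homog0_mderiv i homY) mul0r.
  have hg : homog 0 (grad_dot Y Z) by rewrite gYZ; exact: rpred0.
  rewrite (ball_grad_radial _ _ homY homZ hg) gYZ.
  have -> : sphere_int 0 (0 : mpoly d R) = 0.
    by rewrite (sphere_int_gauss d0 (rpred0 _)) gauss0 mulr0 mul0r.
  rewrite eb !mul0r addr0 !mulr0 !scale0r !addr0 add0r sob_dot0E.
  have e1 : (d%:R - 2) / 2 = d%:R / 2 - 1 :> R by field.
  have e2 : d%:R / 2 - 1 + mu + 1 = d%:R / 2 + mu :> R by ring.
  have b1 : -1 < d%:R / 2 - 1 :> R by rewrite ltrBrDr addNr.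
  rewrite e1 e2 (beta_intZ _ _ b1) -(mulrA ('X + 1)) (beta_intX1 _ b1) subrK.
  move: (beta_int mu _ _) (beta_int mu _ _) (sphere_int _ (Y * Z)).
  move: (2 `^ _) (sphere_int _ _) (Gamma (d%:R / 2)) (Gamma (mu + 1)) (Gamma _).
  move=> P S G1 G2 G3 B1 B2 T /lt0r_neq0 P0 /lt0r_neq0 S0 /lt0r_neq0 G10
    /lt0r_neq0 G20 /lt0r_neq0 G30; field.
  by rewrite P0 S0 G10 G20 G30.
rewrite (ball_grad_radial _ _ homY homZ (homog_grad_dot homY homZ)).
rewrite (sphere_int_grad_dot d0 hY hZ) eb (sob_dotSE _ _ erefl).
have -> : (m + m + d)%:R / 2 - 1 = m.+1%:R + (d%:R - 2) / 2 - 1 :> R.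
  by rewrite -[m.+1]addn1 !natrD; field.
move: (_ * (2 * m.+1%:R + d%:R - 2)) => A.
move: (beta_int mu _ (f * g)) (beta_int mu _ (_ + _)) (beta_int mu _ (f * g)).
move: (sphere_int _ (Y * Z)).
move: (2 `^ _) (sphere_int _ _) (Gamma (d%:R / 2)) (Gamma (mu + 1)) (Gamma _).
move=> P S G1 G2 G3 T B1 B2 B3 /lt0r_neq0 P0 /lt0r_neq0 S0 /lt0r_neq0 G30
  /lt0r_neq0 G10 /lt0r_neq0 G20; field.
by rewrite P0 S0 G10 G20 G30.
Qed.

Lemma ball_dot_radial_ortho m n Y Z f g : m != n ->
  harmonic_poly R d m Y -> harmonic_poly R d n Z ->
  ball_dot lam mu (radial_mul f Y) (radial_mul g Z) = 0.
Proof.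
move=> mn hY hZ; have [homY _] := hY; have [homZ _] := hZ.
have YZ0 : gauss (Y * Z) = 0 by exact: gauss_harmonic_ortho hY hZ mn.
have gr0 : gauss (grad_dot Y Z) = 0 by rewrite (gauss_grad_dot Y hZ) YZ0 mulr0.
have [l hl] : exists l, homog l (grad_dot Y Z).
  case: m n homY homZ {mn hY hZ} => [|m] [|n] homY homZ.
  - by exists 0; rewrite /grad_dot big1 ?rpred0// => i _; rewrite (homog0_mderiv i homY) mul0r.
  - by exists 0; rewrite /grad_dot big1 ?rpred0// => i _; rewrite (homog0_mderiv i homY) mul0r.
  - by exists 0; rewrite /grad_dot big1 ?rpred0// => i _; rewrite (homog0_mderiv i homZ) mulr0.
  - by exists (m + n)%N; exact: homog_grad_dot.
rewrite /ball_dot (ball_int_radial _ _ homY homZ) (ball_grad_radial _ _ homY homZ hl).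
rewrite (sphere_int_gauss d0 hl) (sphere_int_gauss d0 (dhomogM homY homZ)) YZ0 gr0.
by rewrite !(mulr0, mul0r, addr0).
Qed.

End ball_dot_formula.

(** * Fischer decomposition *)

Section fischer.
Context {R : realType} {d : nat}.
Hypothesis d0 : (0 < d)%N.
Local Notation homog k p := (p \is ishomog1 k mdeg).
Local Notation Xi i := (mpolyX R (mnm1 (i : 'I_d))).
Local Notation s := (@normsq_poly R d).
Implicit Types (p q u h : mpoly d R).

Lemma laplacianD p q : laplacian (p + q) = laplacian p + laplacian q.
Proof. by rewrite /laplacian -big_split/=; apply: eq_bigr => i _; rewrite !mderivD. Qed.

Lemma laplacianZ a p : laplacian (a *: p) = a *: laplacian p.
Proof. by rewrite /laplacian scaler_sumr; apply: eq_bigr => i _; rewrite !mderivZ. Qed.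

Lemma laplacian_sum (I : Type) (r : seq I) (P : pred I) (F : I -> mpoly d R) :
  laplacian (\sum_(j <- r | P j) F j) = \sum_(j <- r | P j) laplacian (F j).
Proof.
apply: (big_morph _ laplacianD).
by rewrite /laplacian big1 => [|i _]; rewrite ?mderiv0.
Qed.

Lemma homog_laplacian k p : homog k.+2 p -> homog k (laplacian p).
Proof. by move=> hp; apply: rpred_sum => i _; do 2 apply: homog_mderiv. Qed.

Lemma homog_normsq : homog 2 s.
Proof.
apply: rpred_sum => i _; rewrite -[2%N]/(1 * 2)%N; apply: dhomogMn.
by rewrite dhomogX; apply/eqP; exact: mdeg1.
Qed.

Lemma homog_normsqX j k h : homog k h -> homog (2 * j + k) (s ^+ j * h).
Proof. by move=> hh; apply: dhomogM => //; apply: dhomogMn; exact: homog_normsq. Qed.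

(** The product rule leaves the cross term 4 x . grad q, which Euler's identity turns into 4k q. *)
Lemma laplacian_normsqM k q : homog k q ->
  laplacian (s * q) = (2 * d%:R + 4 * k%:R) *: q + s * laplacian q.
Proof.
move=> hq; rewrite scalerDl -(scalerA 4) -(euler_homog hq).
have -> : (2 * d%:R) *: q = \sum_(i < d) 2 *: q.
  by rewrite -scaler_suml sumr_const card_ord mulr_natr.
rewrite /laplacian mulr_sumr scaler_sumr -!big_split/=; apply: eq_bigr => i _.
rewrite mderivM mderivD !mderivM mderiv_normsq mderivMn mderivXU eqxx mulr1n !scaler_nat.
ring.
Qed.

(** The scalar is positive for d > 0, so each |x|^(2j) h has an explicit preimage under the
    Laplacian. *)
Lemma laplacian_normsqX j m h : harmonic_poly R d m h ->
  laplacian (s ^+ j.+1 * h) =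
  (2 * j.+1%:R * (2 * j%:R + 2 * m%:R + d%:R)) *: (s ^+ j * h).
Proof.
move=> [hh lh]; elim: j => [|j IH].
  rewrite expr1 (laplacian_normsqM hh) lh mulr0 addr0 expr0 mul1r.
  by congr (_ *: _); ring.
rewrite exprS -mulrA (laplacian_normsqM (homog_normsqX j.+1 hh)) IH.
rewrite -scalerAr mulrA -exprS -scalerDl; congr (_ *: _).
rewrite natrD natrM -(natr1 j.+1) -(natr1 j); ring.
Qed.

(** Induction in steps of two. Decomposing the Laplacian of u and lifting each summand gives [f]
    with the same Laplacian as u; the harmonic remainder u - f is the new term j = 0. Below degree 2
    everything is harmonic. *)
Lemma fischer k u : homog k u -> exists h : nat -> mpoly d R,
  (forall j, (2 * j <= k)%N -> harmonic_poly R d (k - 2 * j) (h j)) /\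
  u = \sum_(j < k./2.+1) s ^+ j * h j.
Proof.
have base l : (l < 2)%N -> forall u, homog l u -> exists h : nat -> mpoly d R,
  (forall j, (2 * j <= l)%N -> harmonic_poly R d (l - 2 * j) (h j)) /\
  u = \sum_(j < l./2.+1) s ^+ j * h j.
  move=> l2 v hv; exists (fun=> v); split.
    move=> j jl; have -> : j = 0%N.
      by case: j jl l2 => // j; case: l {hv} => [|[]]//; rewrite mulnS.
    rewrite muln0 subn0; split=> //; apply: big1 => i _.
    case: l l2 hv {jl} => [|[|//]] _ hv; first by rewrite (homog0_mderiv i hv) mderiv0.
    by rewrite (homog0_mderiv i) //; exact: homog_mderiv.
  have -> : l./2 = 0%N by case: l l2 {hv} => [|[|]].
  by rewrite big_ord1 expr0 mul1r.
have [N] := ubnP k; elim: N k u => // N IH [|[|k]] u kN hu; [exact: base|exact: base|].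
have [h [hh lE]] := IH k _ (ltnW kN) (homog_laplacian hu).
pose c j : R := 2 * j.+1%:R * (2 * j%:R + 2 * (k - 2 * j)%:R + d%:R).
have c0 j : c j != 0.
  by rewrite gt_eqF// !mulr_gt0// ltr_wpDl ?ltr0n// addr_ge0// mulr_ge0.
pose f := \sum_(j < k./2.+1) s ^+ j.+1 * ((c j)^-1 *: h j).
have jk (j : 'I_(k./2.+1)) : (2 * j <= k)%N.
  by rewrite mul2n -geq_half_double -ltnS.
have homf : homog k.+2 f.
  apply: rpred_sum => j _; rewrite -scalerAr; apply: rpredZ.
  have [homh _] := hh j (jk j).
  have := homog_normsqX j.+1 homh.
  by rewrite mulnS -addnA subnKC ?jk.
exists (fun j => if j is j'.+1 then (c j')^-1 *: h j' else u - f); split.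
  move=> [_|j jk2]; last first.
    have jk3 : (2 * j <= k)%N by move: jk2; rewrite mulnS.
    have -> : (k.+2 - 2 * j.+1)%N = (k - 2 * j)%N by rewrite mulnS.
    have [homh lh] := hh j jk3.
    by split; [exact: rpredZ|rewrite laplacianZ lh scaler0].
  rewrite muln0 subn0; split; first exact: rpredB.
  rewrite -scaleN1r laplacianD laplacianZ scaleN1r lE laplacian_sum -sumrB big1// => j _.
  rewrite -scalerAr laplacianZ (laplacian_normsqX j (hh j (jk j))) scalerA.
  by rewrite mulVf ?scale1r ?subrr.
by rewrite big_ord_recl expr0 mul1r subrK.
Qed.

End fischer.

(** * The Sobolev inner product on the ball *)

Section ball_form.
Context {R : realType} {d : nat}.
Hypothesis d0 : (0 < d)%N.
Local Notation L := (lebesgue_n R d).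
Local Notation homog k p := (p \is ishomog1 k mdeg).
Implicit Types (p f g h : mpoly d R) (x : Rn R d).
Variables (lam mu : R) (lam0 : 0 < lam) (mu1 : -1 < mu).

Definition ball_fun p : R :=
  \int[L]_(x in unit_ball R d) (mpeval p x * ball_weight mu x).

(** Polar integration applies to homogeneous polynomials, hence the splitting into components. *)
Lemma ball_fun_integrable p :
  L.-integrable (unit_ball R d) (fun x => (mpeval p x * ball_weight mu x)%:E).
Proof.
have -> : (fun x => (mpeval p x * ball_weight mu x)%:E) = (fun x =>
    \sum_(k < mpsize p) (mpeval (pihomog mdeg k p) x * ball_weight mu x)%:E)%E.
  apply/funext => x; rewrite sumEFin -mulr_suml; congr (_ * _)%:E.
  rewrite {1}(pihomog_partitionE (mf := mdeg) (leqnn (mpsize p))).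
  by rewrite /mpeval raddf_sum.
apply: integrable_sum => // [|k _]; first exact: measurable_unit_ball.
have := ball_weight_integrable d0 mu1 (pihomogP mdeg k p) 1.
apply: eq_integrable; first exact: measurable_unit_ball.
by move=> x _; rewrite /= hornerC mul1r.
Qed.

Lemma ball_funD f g : ball_fun (f + g) = ball_fun f + ball_fun g.
Proof.
rewrite /ball_fun -RintegralD; [|exact: measurable_unit_ball|exact: ball_fun_integrable..].
by apply: eq_Rintegral => x _; rewrite mpevalD mulrDl.
Qed.

Lemma ball_funZ a f : ball_fun (a *: f) = a * ball_fun f.
Proof.
rewrite /ball_fun -RintegralZl; [|exact: measurable_unit_ball|exact: ball_fun_integrable].
by apply: eq_Rintegral => x _; rewrite /mpeval mevalZ mulrA.
Qed.

Lemma ball_dotE f g : ball_dot lam mu f g =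
  @ball_const R d mu * (ball_fun (f * g) + lam * ball_fun (grad_dot f g)).
Proof.
rewrite /ball_dot; congr (_ * (_ + _)).
by apply: eq_Rintegral => x _; rewrite mpevalM.
Qed.

Lemma ball_dotC f g : ball_dot lam mu f g = ball_dot lam mu g f.
Proof. by rewrite !ball_dotE (mulrC f) (grad_dotC f). Qed.

Lemma ball_dotDl f g h :
  ball_dot lam mu (f + g) h = ball_dot lam mu f h + ball_dot lam mu g h.
Proof.
rewrite !ball_dotE mulrDl (_ : grad_dot (f + g) h = grad_dot f h + grad_dot g h).
  by rewrite !ball_funD; ring.
by rewrite /grad_dot -big_split/=; apply: eq_bigr => i _; rewrite mderivD mulrDl.
Qed.

Lemma ball_dotZl a f h : ball_dot lam mu (a *: f) h = a * ball_dot lam mu f h.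
Proof.
rewrite !ball_dotE -scalerAl (_ : grad_dot (a *: f) h = a *: grad_dot f h).
  by rewrite !ball_funZ; ring.
by rewrite /grad_dot scaler_sumr; apply: eq_bigr => i _; rewrite mderivZ scalerAl.
Qed.

Lemma ball_dot0l h : ball_dot lam mu 0 h = 0.
Proof. by rewrite -[0 in LHS](scale0r 0) ball_dotZl mul0r. Qed.

Lemma ball_dot_suml (I : Type) (r : seq I) (P : pred I) (F : I -> mpoly d R) h :
  ball_dot lam mu (\sum_(i <- r | P i) F i) h =
  \sum_(i <- r | P i) ball_dot lam mu (F i) h.
Proof.
by apply: (big_morph (fun f => ball_dot lam mu f h) (fun f g => ball_dotDl f g h) (ball_dot0l h)).
Qed.

Lemma ball_const_gt0 : 0 < @ball_const R d mu.
Proof.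
have d20 : 0 < d%:R / 2 :> R by rewrite divr_gt0// ltr0n.
have mu0' : 0 < mu + 1 by rewrite -ltrBlDr sub0r.
have md0 : 0 < mu + 1 + d%:R / 2 by rewrite addr_gt0.
rewrite (ball_constE d0 mu1) invr_gt0 mulr_gt0//.
  by rewrite divr_gt0// sphere_int_gt0.
by rewrite divr_gt0 ?mulr_gt0 ?Gamma_gt0.
Qed.

Lemma ball_fun_sqr_ge0 p : 0 <= ball_fun (p * p).
Proof.
apply: Rintegral_ge0 => x _; rewrite mpevalM -expr2 mulr_ge0 ?sqr_ge0//.
exact: powR_ge0.
Qed.

(** A nonzero p vanishes only on a null set, so the weight would be zero almost everywhere. Its
    integral would be 0, and by the convention 1/0 = 0 so would [ball_const], which is positive. *)
Lemma ball_fun_sqr_eq0 p : ball_fun (p * p) = 0 -> p = 0.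
Proof.
move=> pp0; apply/eqP; apply: contraT => pn0.
have mB := @measurable_unit_ball R d.
have ipp := ball_fun_integrable (p * p).
have i1 := ball_fun_integrable 1.
have := ball_const_gt0; rewrite /ball_const (_ : \int[L]_(x in _) _ = 0) ?invr0 ?ltxx//.
have : (\int[L]_(x in unit_ball R d) `|(mpeval (p * p) x * ball_weight mu x)%:E| = 0)%E.
  rewrite -[RHS]/(0%R%:E) -pp0 fineK; last exact: (integrable_fin_num mB ipp).
  apply: eq_integral => x _; rewrite gee0_abs// lee_fin mpevalM -expr2.
  by rewrite mulr_ge0 ?sqr_ge0//; exact: powR_ge0.
move=> /(ae_eq_integral_abs L mB (measurable_int _ ipp)) ae0.
have aep : {ae L, forall x : Rn R d, mpeval p x != 0}.
  exists [set x | mpeval p x = 0]; split.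
  - rewrite -[X in measurable X]setTI.
    exact: (measurable_mpeval p measurableT (measurable_set1 0)).
  - exact: mpeval_null.
  - by move=> x /= /negP; rewrite negbK => /eqP.
rewrite /Rintegral (ae_eq_integral (cst 0%E)) ?integral0//.
- have := measurable_int _ i1; apply: eq_measurable_fun => x _.
  by rewrite /mpeval rmorph1 mul1r.
- apply: filterS2 ae0 aep => x H px Bx.
  have := H Bx; rewrite mpevalM => -[] /eqP.
  by rewrite !mulf_eq0 !(negbTE px)/= => /eqP ->.
Qed.

Lemma ball_dot_eq0 p : ball_dot lam mu p p = 0 -> p = 0.
Proof.
rewrite ball_dotE => /eqP; rewrite mulf_eq0 (gt_eqF ball_const_gt0)/=.
have g0 : 0 <= ball_fun (grad_dot p p).
  rewrite /grad_dot (big_morph ball_fun ball_funD (id1 := 0)).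
    by apply: sumr_ge0 => i _; exact: ball_fun_sqr_ge0.
  by rewrite -[0 in LHS](scale0r 0) ball_funZ mul0r.
rewrite paddr_eq0 ?ball_fun_sqr_ge0 ?mulr_ge0 ?(ltW lam0)//.
by move=> /andP[/eqP /ball_fun_sqr_eq0].
Qed.

End ball_form.

(** * Leading homogeneous parts *)

Section top_part.
Context {R : realType} {d : nat}.
Local Notation homog k p := (p \is ishomog1 k mdeg).
Local Notation s := (@normsq_poly R d).
Implicit Types (p u h Y : mpoly d R) (q w : {poly R}).

Lemma mpsize_leP p n :
  (mpsize p <= n)%N <-> (forall m, (n <= mdeg m)%N -> mcoeff m p = 0).
Proof.
split=> [pn m nm|H].
  apply: memN_msupp_eq0; apply: (@mmeasure_mnm_ge _ _ mdeg).
  exact: leq_trans nm.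
rewrite /mpsize mmeasureE; apply/bigmax_leqP_seq => m mp _.
rewrite ltnNge; apply: contraL mp => nm.
by rewrite -mcoeff_eq0; apply/eqP; exact: H.
Qed.

Lemma mpsize_homog n p : homog n p -> (mpsize p <= n.+1)%N.
Proof.
move=> hp; apply/mpsize_leP => m nm; apply: (dhomog_nemf_coeff hp).
by apply: contraTneq nm => /= ->; rewrite ltnn.
Qed.

Lemma mpsizeD_le p1 p2 n : (mpsize p1 <= n)%N -> (mpsize p2 <= n)%N ->
  (mpsize (p1 + p2)%R <= n)%N.
Proof.
move=> /mpsize_leP H1 /mpsize_leP H2; apply/mpsize_leP => m nm.
by rewrite mcoeffD H1// H2// addr0.
Qed.

Lemma mpsizeZ_le a p n : (mpsize p <= n)%N -> (mpsize (a *: p)%R <= n)%N.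
Proof.
move=> /mpsize_leP H; apply/mpsize_leP => m nm.
by rewrite mcoeffZ H// mulr0.
Qed.

Lemma mpsize_sum_le (I : Type) (r : seq I) (P : pred I) (F : I -> mpoly d R) n :
  (forall i, P i -> (mpsize (F i) <= n)%N) ->
  (mpsize (\sum_(i <- r | P i) F i)%R <= n)%N.
Proof.
move=> H; apply: (big_ind (fun p => (mpsize p <= n)%N)) => //.
  by rewrite /mpsize mmeasure0.
by move=> p1 p2; exact: mpsizeD_le.
Qed.

Lemma homog_small_eq0 n p : homog n p -> (mpsize p <= n)%N -> p = 0.
Proof.
move=> hp /mpsize_leP H; apply/mpolyP => m; rewrite mcoeff0.
have [mn|mn] := eqVneq (mdeg m) n; first by rewrite H// mn.
exact: dhomog_nemf_coeff hp mn.
Qed.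

Lemma horner_alg_comp (u : mpoly d R) q w :
  horner_alg u (q \Po w) = horner_alg (horner_alg u w) q.
Proof.
elim/poly_ind: q => [|q c IH]; first by rewrite comp_poly0 !raddf0.
rewrite comp_polyD comp_polyM comp_polyX comp_polyC !rmorphD !rmorphM/= IH.
by rewrite !horner_algC horner_algX.
Qed.

Lemma horner_alg_coef (u : mpoly d R) q :
  horner_alg u q = \sum_(i < size q) q`_i *: u ^+ i.
Proof.
rewrite -{1}[q]coefK poly_def raddf_sum/=; apply: eq_bigr => i _.
by rewrite -mul_polyC rmorphM/= horner_algC rmorphXn/= horner_algX mulr_algl.
Qed.

(** Composing q with 2X - 1 multiplies the leading coefficient by 2^j, and the lower powers of |x|^2
    lower the degree. As [mpsize] exceeds the degree by one, the bound says degree below 2j + m. *)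
Lemma radial_mul_top j m q Y : size q = j.+1 -> homog m Y ->
  (mpsize (radial_mul q Y - (lead_coef q * 2 ^+ j) *: (s ^+ j * Y))%R <=
    2 * j + m)%N.
Proof.
move=> sq hY; pose v : {poly R} := 2 *: 'X - 1.
have v2 : size v = 2%N.
  by rewrite /v size_polyDl ?size_polyN ?size_poly1 size_scale ?size_polyX ?pnatr_eq0.
have lv : lead_coef v = 2.
  by rewrite lead_coefE v2 /v coefB coefZ coefX coef1 mulr1 subr0.
have uE : radial_arg = horner_alg s v.
  by rewrite /radial_arg /v -mul_polyC rmorphB rmorphM/= horner_algC horner_algX rmorph1
    mulr_algl.
rewrite /radial_mul -/radial_arg uE -horner_alg_comp horner_alg_coef.
have sqv : size (q \Po v) = j.+1 by rewrite size_comp_poly2.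
have lqv : (q \Po v)`_j = lead_coef q * 2 ^+ j.
  by rewrite -[j in _`_j]/(j.+1.-1) -sqv -lead_coefE lead_coef_comp ?v2// lv sq.
rewrite sqv big_ord_recr/= lqv mulrDl -scalerAl addrK mulr_suml.
apply: mpsize_sum_le => i _; rewrite -scalerAl; apply: mpsizeZ_le.
apply: leq_trans (mpsize_homog (homog_normsqX i hY)) _.
by rewrite -addSn leq_add2r ltn_mul2l/=.
Qed.

(** With t = 2|x|^2 - 1, |x|^2 is (t + 1)/2. This puts Fischer summands in the form to which
    [ball_dot_radial] applies. *)
Lemma normsqX_radial i h : exists2 w : {poly R}, (size w <= i.+1)%N &
  s ^+ i * h = radial_mul w h.
Proof.
pose w : {poly R} := 2^-1 *: ('X + 1).
have w2 : (size w <= 2)%N.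
  by apply: leq_trans (size_scale_leq _ _) _; rewrite -[1]/(1%:P) size_XaddC.
exists (w ^+ i).
  apply: leq_trans (size_poly_exp_leq _ _) _; rewrite ltnS.
  by case: (size w) w2 => [|[|[|]]]//=; rewrite ?mul0n ?mul1n.
rewrite /radial_mul -/radial_arg rmorphXn/= /w -mul_polyC rmorphM rmorphD/=.
rewrite horner_algC horner_algX rmorph1 mulr_algl.
by rewrite /radial_arg subrK scalerA mulVf ?scale1r ?pnatr_eq0.
Qed.

End top_part.

(** * Orthogonal basis of the ball polynomials *)

Section sobolev_ball.
Context {R : realType} {d : nat}.
Hypothesis d0 : (0 < d)%N.
Local Notation homog k p := (p \is ishomog1 k mdeg).
Local Notation s := (@normsq_poly R d).
Implicit Types (p g h Y : mpoly d R) (q : {poly R}).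
Variables (lam mu : R) (mu1 : -1 < mu).

Lemma radial_mul_ball_ortho n j q Y : (2 * j <= n)%N ->
  is_sob_poly d lam mu (sob_beta d n j) j q ->
  harmonic_poly R d (n - 2 * j) Y -> Y != 0 ->
  ball_ortho R d lam mu n (radial_mul q Y) /\ radial_mul q Y != 0.
Proof.
move=> jn [sq lq oq] hY Y0; have [homY _] := hY.
have q0 : lead_coef q != 0 by rewrite lead_coef_eq0 -size_poly_eq0 sq.
have := radial_mul_top sq homY; rewrite subnKC//.
set c := lead_coef q * 2 ^+ j; set T := s ^+ j * Y => top.
have homT : homog n T by have := homog_normsqX j homY; rewrite subnKC.
have T0 : T != 0 by rewrite mulf_neq0// expf_neq0// normsq_neq0.
have c0 : c != 0 by rewrite mulf_neq0// expf_neq0// pnatr_eq0.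
(* If the degree were below n, so would be that of c T, which is homogeneous of degree n and
   nonzero. *)
have szn : (n < mpsize (radial_mul q Y))%N.
  rewrite ltnNge; apply/negP => small.
  suff : c *: T = 0 by move/eqP; rewrite scaler_eq0 (negbTE c0) (negbTE T0).
  apply: (@homog_small_eq0 _ _ n); first exact: rpredZ.
  have -> : c *: T = radial_mul q Y + (-1) *: (radial_mul q Y - c *: T).
    by rewrite scaleN1r opprB addrC subrK.
  by apply: mpsizeD_le => //; exact: mpsizeZ_le.
have szn1 : (mpsize (radial_mul q Y) <= n.+1)%N.
  rewrite -[radial_mul q Y](subrK (c *: T)); apply: mpsizeD_le.
    exact: leq_trans top (leqnSn n).
  by apply: mpsizeZ_le; exact: mpsize_homog.
split; last by apply: contraTneq szn => ->; rewrite /mpsize mmeasure0.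
split; first by right; apply/eqP; rewrite eqn_leq szn1 szn.
move=> g gn; rewrite (ball_dotC lam mu).
rewrite (pihomog_partitionE (mf := mdeg) gn) (ball_dot_suml d0 lam mu1) big1// => k _.
have [h [hh ->]] := fischer d0 (pihomogP mdeg k g).
rewrite (ball_dot_suml d0 lam mu1) big1// => i _.
have ik : (2 * i <= k)%N by rewrite mul2n -geq_half_double -ltnS.
have [w wi ->] := normsqX_radial i (h i).
have [e|ne] := eqVneq (k - 2 * i)%N (n - 2 * j)%N; last first.
  exact: (ball_dot_radial_ortho d0 lam mu1 w q ne (hh i ik) hY).
rewrite (ball_dotC lam mu) (ball_dot_radial d0 lam mu1 q w hY); last by rewrite -e; exact: hh.
(* Equal harmonic degrees k - 2i = n - 2j with k < n force i < j, so [w] lies in the range where [q]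
   is orthogonal. *)
rewrite oq ?mulr0//; apply: leq_trans wi _.
have kn := ltn_ord k; rewrite -(ltn_pmul2l (isT : 0 < 2)%N).
rewrite -(ltn_add2r (n - 2 * j)) (subnKC jn) -e (subnKC ik).
exact: kn.
Qed.

End sobolev_ball.

(* The power of 2 in the norm formula is beta_j + mu + 1: with n = 0 the left
   side is 1, and the exponent beta_j + mu would make the right side 2. *)
Theorem theorem5p2 (R : realType) (d n : nat) (lam mu : R)
    (q : 'I_(n./2.+1) -> {poly R})
    (Y : forall j : 'I_(n./2.+1),
       'I_(dimension (harmonic_poly R d (n - 2 * j))) -> mpoly d R)
    (hd : (0 < d)%N) (hlam : 0 < lam) (hmu : -1 < mu)
    (hq : forall j : 'I_(n./2.+1),
       is_sob_poly d lam mu (sob_beta d n j) j (q j))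
    (hYbasis : forall j : 'I_(n./2.+1),
       is_basis (harmonic_poly R d (n - 2 * j)) (Y j))
    (hYortho : forall (j : 'I_(n./2.+1)) k l,
       sphere_dot (Y j k) (Y j l) = (k == l)%:R) :
  let J := {j : 'I_(n./2.+1) & 'I_(dimension (harmonic_poly R d (n - 2 * j)))}
  in
  let P (s : J) : mpoly d R := radial_mul (q (tag s)) (Y (tag s) (tagged s)) in
  [/\ is_basis (ball_ortho R d lam mu n) P,
      forall s t : J, s != t -> ball_dot lam mu (P s) (P t) = 0
    & forall s : J,
        let j := tag s in
        let beta : R := sob_beta d n j in
        ball_dot lam mu (P s) (P s) =
        Gamma (mu + 1 + d%:R / 2%:R) /
          (Gamma (mu + 1) * Gamma (d%:R / 2%:R) * 2%:R `^ (beta + mu + 1)) *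
        sob_dot d lam mu beta (q j) (q j)].
Proof.
move=> J P.
have jn (j : 'I_(n./2.+1)) : (2 * j <= n)%N by rewrite mul2n -geq_half_double -ltnS.
have hY (j : 'I_(n./2.+1)) k : harmonic_poly R d (n - 2 * j) (Y j k) by have [] := hYbasis j.
have Y0 (j : 'I_(n./2.+1)) k : Y j k != 0.
  apply/eqP => Yjk; have := hYortho j k k.
  rewrite (sphere_dotE hd (hY j k).1 (hY j k).1) Yjk mul0r eqxx.
  rewrite (sphere_int_gauss hd (rpred0 _)) gauss0 mulr0 !mul0r.
  by move=> /esym/eqP; rewrite oner_eq0.
have hP (s : J) : ball_ortho R d lam mu n (P s) /\ P s != 0.
  exact: (radial_mul_ball_ortho hd hmu (jn _) (hq _) (hY _ _) (Y0 _ _)).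
have Porth (s t : J) : s != t -> ball_dot lam mu (P s) (P t) = 0.
  case: s t => [j k] [j' k']; rewrite /P/=.
  have [e|ne] := eqVneq j j'; last first.
    move=> _; apply: (ball_dot_radial_ortho hd lam hmu _ _ _ (hY _ _) (hY _ _)).
    (* Since 2j <= n, the subtraction is exact and n - 2j determines j. *)
    apply: contraNneq ne => e; apply/eqP/val_inj/eqP => /=.
    rewrite -(eqn_pmul2l (isT : 0 < 2)%N).
    by rewrite -(eqn_add2l (n - 2 * j)) (subnK (jn j)) e (subnK (jn j')).
  subst j' => kk'; rewrite (ball_dot_radial hd lam hmu _ _ (hY _ _) (hY _ _)).
  rewrite hYortho; have [e|_] := eqVneq k k'; last by rewrite mul0r.
  by move: kk'; rewrite e eqxx.
split=> //; last first.
  case=> j k; rewrite /P/= (ball_dot_radial hd lam hmu _ _ (hY _ _) (hY _ _)).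
  by rewrite hYortho eqxx mul1r.
have norm0 (s : J) : ball_dot lam mu (P s) (P s) != 0.
  apply/eqP => /(ball_dot_eq0 hd hlam hmu) /eqP.
  exact/negP/(hP s).2.
split=> [s|c c0 t|v [vn vortho]]; first exact: (hP s).1.
- have := ball_dot0l hd lam hmu (P t); rewrite -c0 (ball_dot_suml hd lam hmu).
  rewrite (bigD1 t)//= big1 => [|s st]; last by rewrite (ball_dotZl hd lam hmu) Porth ?mulr0.
  rewrite addr0 (ball_dotZl hd lam hmu) => /eqP.
  by rewrite mulf_eq0 (negbTE (norm0 t)) orbF => /eqP.
- have vn1 : (mpsize v <= n.+1)%N by case: vn => [->|->//]; rewrite /mpsize mmeasure0.
  have [h [hh uE]] := fischer hd (pihomogP mdeg n v).
  have hspan (j : 'I_(n./2.+1)) : exists a : 'I_(dimension (harmonic_poly R d (n - 2 * j))) -> R,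
      h j = \sum_k a k *: Y j k.
    by have [_ _] := hYbasis j; apply; exact: hh.
  pose a (j : 'I_(n./2.+1)) := sval (cid (hspan j)).
  have aE (j : 'I_(n./2.+1)) : h j = \sum_k a j k *: Y j k by exact: svalP (cid (hspan j)).
  pose l (j : 'I_(n./2.+1)) : R := lead_coef (q j) * 2 ^+ j.
  have l0 (j : 'I_(n./2.+1)) : l j != 0.
    have [sq _ _] := hq j.
    by rewrite mulf_neq0 ?expf_neq0 ?pnatr_eq0// lead_coef_eq0 -size_poly_eq0 sq.
  (* The degree n part of the basis element at (j, k) is l_j |x|^(2j) Y_(j,k), so these coefficients
     reproduce that of v. *)
  exists (fun s : J => a (tag s) (tagged s) / l (tag s)).
  set S := \sum_s _; apply/eqP; rewrite -subr_eq0; apply/eqP.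
  have small : (mpsize (v - S)%R <= n)%N.
    have -> : v - S = (v - pihomog mdeg n v) + (pihomog mdeg n v - S) by rewrite addrA subrK.
    apply: mpsizeD_le.
      rewrite {1}(pihomog_partitionE (mf := mdeg) vn1) big_ord_recr/= addrK.
      apply: mpsize_sum_le => k _; apply: leq_trans (mpsize_homog (pihomogP mdeg k v)) _.
      exact: ltn_ord.
    rewrite uE /S -(sig_big_dep xpredT (fun _ => xpredT) (fun j k =>
      (a j k / l j) *: radial_mul (q j) (Y j k)))/=.
    rewrite -sumrB; apply: mpsize_sum_le => j _.
    rewrite aE mulr_sumr -sumrB; apply: mpsize_sum_le => k _.
    have [sq _ _] := hq j; have [homY _] := hY j k.
    have := radial_mul_top sq homY; rewrite subnKC// => top.
    have := mpsizeZ_le (- (a j k / l j)) top; congr (mpsize _ <= _)%N.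
    rewrite scalerBr !scaleNr opprK addrC scalerA -/(l j) mulfVK//.
    by rewrite -scalerAr.
  have wortho g : (mpsize g <= n)%N -> ball_dot lam mu (v - S) g = 0.
    move=> gn; rewrite -scaleN1r (ball_dotDl hd lam hmu) (ball_dotZl hd lam hmu).
    rewrite vortho// add0r (ball_dot_suml hd lam hmu) big1 ?mulr0// => s _.
    by rewrite (ball_dotZl hd lam hmu) (hP s).1.2 ?mulr0.
  (* v - S has degree below n and is orthogonal to all such polynomials, so it may be paired with
     itself. *)
  exact: (ball_dot_eq0 hd hlam hmu (wortho _ small)).
Qed.
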